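(* Let $G$ be a locally compact, second countable, Hausdorff topological group, $U$ a projective representation of $G$ in a separable complex Hilbert space $\mathcal{H}$, and $\{\mu_t\}_{t\ge0}$ a continuous convolution semigroup of measures on $G$. Let $\{\mathfrak{S}_t\colon\mathcal{B}_1(\mathcal{H})\to\mathcal{B}_1(\mathcal{H})\}_{t\ge0}$ be the contraction semigroup $$\mathfrak{S}_t\hat A:=\int_G U(g)\,\hat A\,U(g)^*\,d\mu_t(g),\qquad \hat A\in\mathcal{B}_1(\mathcal{H}),$$ where the integral is a weak integral. Then $\{\mathfrak{S}_t\}_{t\ge0}$ is a quantum dynamical semigroup.
   Context: $\mathcal{B}(\mathcal{H})$ is the space of bounded operators and $\mathcal{B}_1(\mathcal{H})$ the Banach space of trace class operators with the trace norm; the dual of $\mathcal{B}_1(\mathcal{H})$ is identified with $\mathcal{B}(\mathcal{H})$ via $(\hat B,\hat A)\mapsto\mathrm{tr}(\hat B\hat A)$. **Projective representation.** A weakly Borel map $U$ from $G$ to the unitary group of $\mathcal{H}$ (i.e. $g\mapsto\langle\phi,U(g)\psi\rangle$ is Borel for all $\phi,\psi$) with $U(e)=I$ and $U(gh)=\mathsf{m}(g,h)U(g)U(h)$ for some Borel function $\mathsf{m}\colon G\times G\to\mathbb{T}$ (the circle group). **Continuous convolution semigroup of measures.** A family $\{\mu_t\}_{t\ge0}$ of Borel probability measures on $G$ with $\mu_t\star\mu_s=\mu_{t+s}$, $\mu_0=\delta_e$, and $\mu_t\to\delta_e$ weakly as $t\downarrow0$, where $\int f\,d(\mu\star\nu)=\iint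 f(gh)\,d\mu(g)\,d\nu(h)$. **Weak integral.** The integral defining $\mathfrak{S}_t\hat A$ converges with respect to the weak operator topology in $\mathcal{B}(\mathcal{H})$. **Quantum dynamical semigroup.** A quantum dynamical map in $\mathcal{B}_1(\mathcal{H})$ is a positive, trace-preserving, bounded linear map in $\mathcal{B}_1(\mathcal{H})$ whose adjoint, acting in $\mathcal{B}(\mathcal{H})$, is completely positive. A quantum dynamical semigroup in $\mathcal{B}_1(\mathcal{H})$ is a strongly continuous one-parameter semigroup $\{\mathfrak{Q}_t\}_{t\ge0}$ ($\mathfrak{Q}_0=I$, $\mathfrak{Q}_t\mathfrak{Q}_s=\mathfrak{Q}_{t+s}$) of quantum dynamical maps in $\mathcal{B}_1(\mathcal{H})$. A contraction semigroup is a strongly continuous one-parameter semigroup of operators of norm at most $1$. *)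

(* Defs.v *)
From HB Require Import structures.
From mathcomp Require Import all_boot all_order all_algebra.
From mathcomp Require Import complex.
From mathcomp Require Import all_classical all_reals all_analysis.
From mathcomp Require Import measurable_realfun.

Set Implicit Arguments.
Unset Strict Implicit.
Unset Printing Implicit Defensive.

Import Order.TTheory GRing.Theory Num.Theory.
Import numFieldNormedType.Exports.

Local Open Scope classical_set_scope.
Local Open Scope complex_scope.
Local Open Scope ring_scope.

HB.mixin Record isTopologicalGroup G & PointedTopological G & Group G := {
  mulg_continuous : continuous (fun x : G * G => (x.1 * x.2)%g) ;
  invg_continuous : continuous (fun x : G => (x^-1)%g) }.

(* The base point of [PointedTopological] plays no role; it is only there
   because the library's measurable types are pointed. *)
#[short(type="topologicalGroupType")]
HB.structure Definition TopologicalGroup :=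
  {G of PointedTopological G & Group G & isTopologicalGroup G}.

HB.instance Definition _ (X Y : ptopologicalType) := Pointed.on (X * Y)%type.

Notation borel T := (g_sigma_algebraType (@open T)).

Definition borel_map (X Y : ptopologicalType) (f : X -> Y) : Prop :=
  measurable_fun [set: borel X] (f : borel X -> borel Y).

(* The library form [dotp] is linear in its first argument. *)
HB.mixin Record isHilbert (R : realType) H & CompleteNormedModule R[i] H := {
  dotp : {dot H for (@Num.conj R[i])} ;
  dotp_norm : forall x : H, dotp x x = `|x| ^+ 2 }.

#[short(type="hilbertType")]
HB.structure Definition Hilbert (R : realType) :=
  {H of CompleteNormedModule R[i] H & isHilbert R H}.

(* Conjugate-linear in [x], linear in [y]. *)
Definition inner (R : realType) (H : hilbertType R) (x y : H) : R[i] :=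
  dotp y x.

Definition separable (T : topologicalType) : Prop :=
  exists D : set T, countable D /\ dense D.

Section BoundedOperators.
Context (R : realType) (H : hilbertType R).
Implicit Types f g : H -> H.

Definition bounded_operator f : Prop :=
  linear f /\ exists M : R, forall x, `|f x| <= M%:C * `|x|.

Definition bopP : {pred H -> H} := fun f => `[< bounded_operator f >].

Fact bopP_submod : submod_closed bopP.
Proof.
split.
  apply/asboolP; split; first by move=> a x y /=; rewrite scaler0 addr0.
  by exists 0 => x /=; rewrite normr0 mul0r.
move=> a f g /asboolP[lf [M fM]] /asboolP[lg [N gN]]; apply/asboolP; split.
  move=> b x y /=; rewrite !fctE /= lf lg !scalerDr !scalerA (mulrC a b).
  by rewrite addrACA.
exists (complex.Re `|a| * M + N) => x; rewrite !fctE /=.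
rewrite (le_trans (ler_normD _ _))// normrZ rmorphD rmorphM /= mulrDl lerD//.
by rewrite -[(Normc.normc a)%:C]/`|a| -mulrA ler_wpM2l.
Qed.

HB.instance Definition _ := GRing.isSubmodClosed.Build R[i] (H -> H) bopP
  bopP_submod.

End BoundedOperators.

Arguments bopP {R} H.

Record bop (R : realType) (H : hilbertType R) :=
  Bop { bop_val :> H -> H ; _ : bop_val \in bopP H }.

Section BopInstances.
Context (R : realType) (H : hilbertType R).

HB.instance Definition _ := [isSub for @bop_val R H].
HB.instance Definition _ := [Choice of bop H by <:].
HB.instance Definition _ := [SubChoice_isSubLmodule of bop H by <:].

End BopInstances.

Notation "''B(' H )" := (bop H) (format "''B(' H )") : type_scope.

Section BopAlgebra.
Context (R : realType) (H : hilbertType R).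
Implicit Types A B : 'B(H).

Fact bop_id_subproof : (fun x : H => x) \in bopP H.
Proof.
by apply/asboolP; split => //; exists 1 => x; rewrite rmorph1 mul1r.
Qed.

Definition bop_id : 'B(H) := Bop bop_id_subproof.

Fact bop_comp_subproof A B : (fun x : H => A (B x)) \in bopP H.
Proof.
case: A B => [A /= /asboolP[lA [M AM]]] [B /= /asboolP[lB [N BN]]].
apply/asboolP; split; first by move=> a x y; rewrite lB lA.
exists (`|M| * N) => x; rewrite (le_trans (AM _))// rmorphM /= -mulrA.
rewrite (@le_trans _ _ (`|M|%:C * `|B x|)) ?ler_wpM2r ?lecR ?ler_norm//.
by rewrite ler_wpM2l ?lecR.
Qed.

Definition bop_comp A B : 'B(H) := Bop (bop_comp_subproof A B).

Local Notation "A ** B" := (bop_comp A B) (at level 40, left associativity).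

(* [bop_adj A] is the Hilbert space adjoint of [A]: it exists by the Riesz
   representation theorem and is unique. *)
Definition bop_adj A : 'B(H) :=
  xget 0 [set B : 'B(H) | forall x y, inner (B x) y = inner x (A y)].

Definition bop_unitary A : Prop :=
  bop_adj A ** A = bop_id /\ A ** bop_adj A = bop_id.

(* The order of [R[i]] makes [0 <= z] say that [z] is real and nonnegative. *)
Definition bop_pos A : Prop := forall x, 0 <= inner x (A x).

(* The positive square root of [A^* A], which exists and is unique. *)
Definition bop_abs A : 'B(H) :=
  xget 0 [set P : 'B(H) | bop_pos P /\ P ** P = bop_adj A ** A].

End BopAlgebra.

Notation "A ** B" := (bop_comp A B) (at level 40, left associativity)
  : ring_scope.

(* [rsum] and [csum] are meant for absolutely summable families. *)
Definition rsum (R : realType) (I : choiceType) (D : set I) (f : I -> R) : R :=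
  fine (\esum_(i in D) (EFin \o f)^\+ i - \esum_(i in D) (EFin \o f)^\- i)%E.

Definition csum (R : realType) (I : choiceType) (D : set I) (f : I -> R[i]) :
    R[i] :=
  rsum D (fun i => complex.Re (f i)) +i* rsum D (fun i => complex.Im (f i)).

Section TraceClass.
Context (R : realType) (H : hilbertType R).
Implicit Types (A B : 'B(H)) (E : set H).

Definition orthonormal_basis E : Prop :=
  [/\ forall e, E e -> inner e e = 1,
      forall e f, E e -> E f -> e <> f -> inner e f = 0 &
      forall x, (forall e, E e -> inner e x = 0) -> x = 0].

(* A fixed orthonormal basis (one exists by Zorn's lemma).  Neither the trace
   class, nor the trace norm, nor the trace depends on it. *)
Definition onb : set H := xget set0 orthonormal_basis.

Definition abs_trace A : \bar R :=
  (\esum_(e in onb) (complex.Re (inner e (bop_abs A e)))%:E)%E.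

Definition trace_class : set 'B(H) := [set A | (abs_trace A < +oo)%E].

Definition trace_norm A : R := fine (abs_trace A).

Definition trace A : R[i] := csum onb (fun e => inner e (A e)).

End TraceClass.

Arguments trace_class {R} H.

(* A map in $B_1(H)$ is represented by a function on $B(H)$ which sends trace
   class operators to trace class operators; its values outside $B_1(H)$ are
   irrelevant. *)

Section Semigroups.
Context (R : realType) (H : hilbertType R).
Implicit Types (Q : 'B(H) -> 'B(H)) (S : R -> 'B(H) -> 'B(H)).

Local Notation B1 := (trace_class H).

Definition B1_linear Q : Prop :=
  (forall A, B1 A -> B1 (Q A)) /\
  (forall (a : R[i]) A B, B1 A -> B1 B -> Q (a *: A + B) = a *: Q A + Q B).

Definition B1_bounded_by (c : R) Q : Prop :=
  forall A, B1 A -> trace_norm (Q A) <= c * trace_norm A.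

(* [B1_adjoint Q Qs]: under the identification of the dual of $B_1(H)$ with
   $B(H)$ by $(B, A) \mapsto tr(BA)$, [Qs] is the adjoint of [Q]; this
   determines [Qs]. *)
Definition B1_adjoint Q (Qs : 'B(H) -> 'B(H)) : Prop :=
  forall B A, B1 A -> trace (Qs B ** A) = trace (B ** Q A).

(* Every amplification of [Q] to $M_n(B(H)) = B(H^n)$ is positive. *)
Definition completely_positive Q : Prop :=
  forall (n : nat) (B : 'I_n -> 'I_n -> 'B(H)),
    (forall x : 'I_n -> H, 0 <= \sum_i \sum_j inner (x i) (B i j (x j))) ->
    (forall x : 'I_n -> H, 0 <= \sum_i \sum_j inner (x i) (Q (B i j) (x j))).

Record quantum_dynamical_map Q : Prop := {
  qdm_linear : B1_linear Q ;
  qdm_bounded : exists c, B1_bounded_by c Q ;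
  qdm_positive : forall A, B1 A -> bop_pos A -> bop_pos (Q A) ;
  qdm_trace : forall A, B1 A -> trace (Q A) = trace A ;
  qdm_adjoint_cp : exists2 Qs, B1_adjoint Q Qs & completely_positive Qs }.

Record strongly_continuous_semigroup S : Prop := {
  semigroup0 : forall A, B1 A -> S 0 A = A ;
  semigroupD : forall (t s : R) A, 0 <= t -> 0 <= s -> B1 A ->
    S t (S s A) = S (t + s) A ;
  semigroup_continuous : forall A (t : R), B1 A -> 0 <= t ->
    trace_norm (S s A - S t A) @[s --> within [set s | 0 <= s] (nbhs t)]
      --> (0 : R) }.

Definition contraction_semigroup S : Prop :=
  strongly_continuous_semigroup S /\
  forall t : R, 0 <= t -> B1_linear (S t) /\ B1_bounded_by 1 (S t).

Definition quantum_dynamical_semigroup S : Prop :=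
  strongly_continuous_semigroup S /\
  forall t : R, 0 <= t -> quantum_dynamical_map (S t).

End Semigroups.

Section GroupData.
Context (R : realType) (G : topologicalGroupType) (H : hilbertType R).

Record projective_representation (U : G -> 'B(H)) : Prop := {
  prep_unitary : forall g, bop_unitary (U g) ;
  prep_borel : forall phi psi : H,
    borel_map (fun g => inner phi (U g psi) : R[i]^o) ;
  prep1 : U 1%g = bop_id H ;
  prepM : exists m : G * G -> R[i]^o,
    [/\ borel_map m, forall x, `|m x| = 1 &
      forall g h, U (g * h)%g = (m (g, h) : R[i]) *: (U g ** U h)] }.

Implicit Types mu nu lam : probability (borel G) R.

Definition is_convolution mu nu lam : Prop :=
  forall f : borel G -> \bar R,
    measurable_fun setT f -> (forall g, 0 <= f g)%E ->
    (\int[lam]_x f x = \int[nu]_h \int[mu]_g f (g * h)%g)%E.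

Record convolution_semigroup (mu : R -> probability (borel G) R) : Prop := {
  conv_semigroupD : forall t s : R, 0 <= t -> 0 <= s ->
    is_convolution (mu t) (mu s) (mu (t + s)) ;
  conv_semigroup0 : forall A : set (borel G), measurable A ->
    mu 0 A = \d_(1%g : borel G) A ;
  conv_semigroup_continuous : forall f : G -> R,
    continuous f -> (exists M : R, forall x, `|f x| <= M) ->
    (\int[mu t]_x f x) @[t --> 0^'+] --> f 1%g }.

Definition cintegrable mu (f : borel G -> R[i]) : Prop :=
  mu.-integrable setT (fun x => (complex.Re (f x))%:E) /\
  mu.-integrable setT (fun x => (complex.Im (f x))%:E).

Definition cintegral mu (f : borel G -> R[i]) : R[i] :=
  (\int[mu]_x complex.Re (f x)) +i* (\int[mu]_x complex.Im (f x)).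

(* [B] is the integral of the operator-valued [F] with respect to the weak
   operator topology. *)
Definition is_weak_integral mu (F : G -> 'B(H)) (B : 'B(H)) : Prop :=
  forall phi psi : H,
    cintegrable mu (fun g => inner phi (F g psi)) /\
    inner phi (B psi) = cintegral mu (fun g => inner phi (F g psi)).

End GroupData.

(* Main.v *)
(* By polar decomposition, [A] in B_1(H) is a product [X^* Y] of Hilbert-Schmidt
   operators, and the sum [hs2 Z] of [|Z e|^2] over a basis does not change when
   [Z] is replaced by [Z U^*] with [U] unitary.  By polarization this gives
   tr(B U A U^* ) = tr(U^* B U A), the sums over the basis being bounded
   uniformly in [U]; integrating, and exchanging the integral with the sum over
   the countable basis, shows that the adjoint of [S t] sends [B] to the weak
   integral [Q B] of [U(g)^* B U(g)].  It is completely positive because its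
   integrand is, and the trace is preserved since [Q 1 = 1]. *)
Require Import Defs.
From mathcomp Require Import all_boot all_order all_algebra.
From mathcomp Require Import complex.
From mathcomp Require Import all_classical all_reals all_analysis.
From mathcomp Require Import measurable_realfun.
From mathcomp Require Import ring lra.

Set Implicit Arguments.
Unset Strict Implicit.
Unset Printing Implicit Defensive.

Import Order.TTheory GRing.Theory Num.Theory.
Import numFieldNormedType.Exports.

Local Open Scope classical_set_scope.
Local Open Scope ring_scope.

Local Open Scope complex_scope.

(** The basis, the adjoint and the modulus are chosen by [xget], which says nothing unless the
    object exists. Their existence is therefore proved first, by Zorn's lemma, Riesz representation
    and an iteration for square roots. The diagonal terms of the two traces in the overview differ
    vector by vector: one runs over the basis, the other over its image under a unitary. Squared
    norms are the sums for which such a change of basis follows at once from Parseval and Tonelli,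
    hence the detour through Hilbert-Schmidt factors. Since [U] is only weakly Borel, an integrand
    with [B] between two values of [U] needs its own measurability argument, by expansion in the
    countable basis. Linearity, the trace norm bound and strong continuity are contained in the
    contraction semigroup hypothesis, so the work is done at a fixed time t. *)

(** * Geometry of the real part of the inner product *)

Section InnerProduct.
Context (R : realType) (H : hilbertType R).
Implicit Types (x y z : H) (a : R[i]).

Definition hnorm x : R := complex.Re `|x|.
Definition rinner x y : R := complex.Re (inner x y).
Definition csq a : R := complex.Re a ^+ 2 + complex.Im a ^+ 2.

Lemma innerDr x y z : inner x (y + z) = inner x y + inner x z.
Proof. by rewrite /inner linearDl. Qed.

Lemma innerZr a x y : inner x (a *: y) = a * inner x y.
Proof. by rewrite /inner linearZl_LR. Qed.

Lemma innerC x y : inner x y = conjc (inner y x).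
Proof. by rewrite /inner hermC /= expr0 mul1r. Qed.

Lemma innerDl x y z : inner (x + y) z = inner x z + inner y z.
Proof. by rewrite innerC innerDr rmorphD /= -!innerC. Qed.

Lemma innerZl a x y : inner (a *: x) y = conjc a * inner x y.
Proof. by rewrite innerC innerZr rmorphM /= -innerC. Qed.

Lemma innerBr x y z : inner x (y - z) = inner x y - inner x z.
Proof. by rewrite innerDr -scaleN1r innerZr mulN1r. Qed.

Lemma inner0r x : inner x 0 = 0.
Proof. by rewrite -(scale0r 0) innerZr mul0r. Qed.

Lemma inner0l x : inner 0 x = 0.
Proof. by rewrite innerC inner0r conjc0. Qed.

Lemma csq_ge0 a : 0 <= csq a.
Proof. by rewrite addr_ge0// sqr_ge0. Qed.

Lemma normE x : `|x| = (hnorm x)%:C.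
Proof.
by rewrite /hnorm; have /ger0_Im := normr_ge0 x; case: `|x| => ? ? /= ->.
Qed.

Lemma inner_normE x : inner x x = (hnorm x ^+ 2)%:C.
Proof. by rewrite /inner dotp_norm normE -rmorphXn. Qed.

(** Conjugate-linearity in the first slot makes the imaginary part a real part at ['i *: x]. Complex
    identities thus reduce to real ones, where order, sums and integrals live. *)
Lemma innerE x y : inner x y = rinner x y +i* rinner ('i *: x) y.
Proof.
by rewrite /rinner innerZl; case: (inner x y) => a b /=; congr (_ +i* _); ring.
Qed.


Lemma rinnerC x y : rinner x y = rinner y x.
Proof. by rewrite /rinner innerC; case: (inner y x). Qed.

Lemma rinnerDr x y z : rinner x (y + z) = rinner x y + rinner x z.
Proof. by rewrite /rinner innerDr raddfD. Qed.

Lemma rinnerDl x y z : rinner (x + y) z = rinner x z + rinner y z.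
Proof. by rewrite rinnerC rinnerDr !(rinnerC z). Qed.

Lemma rinnerZr (r : R) x y : rinner x (r%:C *: y) = r * rinner x y.
Proof. by rewrite /rinner innerZr; case: (inner x y) => b c /=; ring. Qed.

Lemma rinnerZl (r : R) x y : rinner (r%:C *: x) y = r * rinner x y.
Proof. by rewrite rinnerC rinnerZr rinnerC. Qed.

Lemma rinnerNr x y : rinner x (- y) = - rinner x y.
Proof. by rewrite -scaleN1r -(rmorphN1 (real_complex R)) rinnerZr mulN1r. Qed.

Lemma rinnerNl x y : rinner (- x) y = - rinner x y.
Proof. by rewrite rinnerC rinnerNr rinnerC. Qed.

Lemma rinnerBr x y z : rinner x (y - z) = rinner x y - rinner x z.
Proof. by rewrite rinnerDr rinnerNr. Qed.

Lemma rinnerBl x y z : rinner (x - y) z = rinner x z - rinner y z.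
Proof. by rewrite rinnerDl rinnerNl. Qed.

Lemma rinner0r x : rinner x 0 = 0.
Proof. by rewrite -(subrr x) rinnerBr subrr. Qed.

Lemma rinner0l x : rinner 0 x = 0.
Proof. by rewrite rinnerC rinner0r. Qed.

Lemma rinnerii x y : rinner ('i *: x) ('i *: y) = rinner x y.
Proof.
by rewrite /rinner innerZl innerZr; case: (inner x y) => b c /=; ring.
Qed.

Lemma rinnerxx x : rinner x x = hnorm x ^+ 2.
Proof. by rewrite /rinner inner_normE. Qed.

Lemma hnorm_ge0 x : 0 <= hnorm x.
Proof. by have := normr_ge0 x; rewrite normE ler0c. Qed.

Lemma hnorm0 : hnorm 0 = 0.
Proof. by rewrite /hnorm normr0. Qed.

Lemma hnorm_eq0 x : hnorm x = 0 -> x = 0.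
Proof. by move=> x0; apply/eqP; rewrite -normr_eq0 normE x0. Qed.

Lemma hnorm_opp x : hnorm (- x) = hnorm x.
Proof. by rewrite /hnorm normrN. Qed.

Lemma hdistC x y : hnorm (x - y) = hnorm (y - x).
Proof. by rewrite -hnorm_opp opprB. Qed.

Lemma ler_hnormD x y : hnorm (x + y) <= hnorm x + hnorm y.
Proof. by rewrite -lecR rmorphD /= -!normE ler_normD. Qed.

Lemma hnorm_sqrD x y :
  hnorm (x + y) ^+ 2 = hnorm x ^+ 2 + 2 * rinner x y + hnorm y ^+ 2.
Proof. by rewrite -!rinnerxx rinnerDl !rinnerDr (rinnerC y x); ring. Qed.

Lemma hnorm_sqrB x y :
  hnorm (x - y) ^+ 2 = hnorm x ^+ 2 - 2 * rinner x y + hnorm y ^+ 2.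
Proof. by rewrite hnorm_sqrD rinnerNr hnorm_opp; ring. Qed.

Lemma hnorm_sqrZ a x : hnorm (a *: x) ^+ 2 = csq a * hnorm x ^+ 2.
Proof.
rewrite -!rinnerxx /rinner innerZl innerZr inner_normE /csq.
by case: a => b c /=; ring.
Qed.

Lemma hnormZ (r : R) x : hnorm (r%:C *: x) = `|r| * hnorm x.
Proof.
apply/(@pexpIrn _ 2) => //; rewrite ?nnegrE ?mulr_ge0 ?hnorm_ge0//.
by rewrite hnorm_sqrZ /csq /= exprMn real_normK ?num_real// expr0n addr0.
Qed.

Lemma parallelogram x y :
  hnorm (x + y) ^+ 2 + hnorm (x - y) ^+ 2 = 2 * (hnorm x ^+ 2 + hnorm y ^+ 2).
Proof. by rewrite hnorm_sqrD hnorm_sqrB; ring. Qed.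

Lemma ler_rinner x y : rinner x y <= hnorm x * hnorm y.
Proof.
(* The square expands to 2|x||y|(|x||y| - Re <x,y>); the factor |x||y| is cancelled once both norms
   are known to be nonzero. *)
have := sqr_ge0 (hnorm ((hnorm y)%:C *: x - (hnorm x)%:C *: y)).
rewrite hnorm_sqrB !hnormZ rinnerZl rinnerZr !ger0_norm ?hnorm_ge0// => h.
have [x0|x0] := eqVneq (hnorm x) 0.
  by rewrite (hnorm_eq0 x0) rinner0l hnorm0 mul0r.
have [y0|y0] := eqVneq (hnorm y) 0.
  by rewrite (hnorm_eq0 y0) rinner0r hnorm0 mulr0.
have xy_gt0 : 0 < hnorm x * hnorm y.
  by rewrite mulr_gt0// lt_neqAle eq_sym ?x0 ?y0 hnorm_ge0.
rewrite -(ler_pM2l xy_gt0); nra.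
Qed.

Lemma ler_norm_rinner x y : `|rinner x y| <= hnorm x * hnorm y.
Proof.
by rewrite ler_norml ler_rinner andbT lerNl -rinnerNl -(hnorm_opp x) ler_rinner.
Qed.

Lemma ler_norm_rinner_sqr x y :
  `|rinner x y| <= 2^-1 * (hnorm x ^+ 2 + hnorm y ^+ 2).
Proof.
apply: le_trans (ler_norm_rinner x y) _.
by have := sqr_ge0 (hnorm x - hnorm y); nra.
Qed.

Lemma rinner_ext x y : (forall z, rinner x z = rinner y z) -> x = y.
Proof.
move=> xy; apply/subr0_eq/hnorm_eq0/eqP; rewrite -sqrf_eq0 -rinnerxx.
by rewrite rinnerBl xy subrr.
Qed.

(** Cauchy criterion with squared distances, which is what Pythagoras and monotone sequences of
    squared norms provide. *)
Lemma hilbert_complete (u : nat -> H) (s : nat -> R) : cvgn s ->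
    (forall m n, (m <= n)%N -> hnorm (u n - u m) ^+ 2 <= `|s n - s m|) ->
  exists l, hnorm (u n - l) @[n --> \oo] --> (0 : R).
Proof.
move=> cs us.
have cu : cvg (u @ \oo).
  apply/cauchy_cvgP/cauchy_exP => e e0.
  have e_gt0 : 0 < complex.Re e by move: e0; rewrite ltcE => /andP[].
  have eE : e = (complex.Re e)%:C.
    by move: e0; rewrite ltcE => /andP[/eqP]; case: (e) => ? ? /= ->.
  (* Two terms of [s] this close to the limit differ by less than the square of e, which bounds a
     squared distance. *)
  have /cvgrPdist_lt/(_ (complex.Re e ^+ 2 / 2)) : s @ \oo --> limn s by [].
  move=> /(_ _)[|N _ sN]; first by rewrite divr_gt0 ?exprn_gt0.
  exists (u N); exists N => // n /= Nn.
  rewrite -ball_normE /= eE normE ltcR hdistC.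
  rewrite -(@ltr_pXn2r _ 2)// ?nnegrE ?hnorm_ge0 ?ltW//.
  apply: le_lt_trans (us _ _ Nn) _.
  have := sN n Nn; have := sN N (leqnn _) => /= h1 h2.
  rewrite (_ : s n - s N = (limn s - s N) - (limn s - s n)); last by ring.
  by rewrite (le_lt_trans (ler_normB _ _))// [ltRHS]splitr ltrD.
exists (lim (u @ \oo)); apply/cvgrPdist_lt => e e0.
have /cvgrPdist_lt/(_ (e%:C)) : u @ \oo --> lim (u @ \oo) by [].
move=> /(_ _)[|N _ uN]; first by rewrite ltcR.
exists N => // n Nn; have := uN n Nn.
by rewrite sub0r normrN ger0_norm ?hnorm_ge0// /= normE ltcR hdistC.
Qed.

End InnerProduct.

(** * Norm limits of vectors and strong limits of operators *)

Section VectorLimits.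
Context (R : realType) (H : hilbertType R).
Implicit Types (u v : nat -> H) (l x y : H) (e f : nat -> R).

Lemma cvg0_le e (c : R) : e @ \oo --> (0 : R) -> (forall n, c <= e n) -> c <= 0.
Proof.
by move=> e0 ce; apply: (ler_cvg_to (cvg_cst c) e0); exact: nearW.
Qed.

Lemma cvg0_squeeze e f (K : R) : e @ \oo --> (0 : R) ->
  (forall n, 0 <= f n <= K * e n) -> f @ \oo --> (0 : R).
Proof.
move=> e0 fe; have Ke0 : (K * e n) @[n --> \oo] --> (0 : R).
  by rewrite -[X in _ --> X](mulr0 K); exact: cvgMl_tmp.
by apply: (squeeze_cvgr _ (cvg_cst 0) Ke0); exact: nearW.
Qed.

Definition hcvg u l := hnorm (u n - l) @[n --> \oo] --> (0 : R).

Lemma hcvg_cst x : hcvg (fun=> x) x.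
Proof. by rewrite /hcvg subrr hnorm0; exact: cvg_cst. Qed.

Lemma hcvgD u v l m : hcvg u l -> hcvg v m -> hcvg (fun n => u n + v n) (l + m).
Proof.
move=> ul vm.
have uv : (fun n => hnorm (u n - l) + hnorm (v n - m)) @ \oo --> (0 : R).
  by rewrite -(addr0 0); exact: cvgD.
rewrite /hcvg; apply: (cvg0_squeeze (K := 1) uv) => n /=.
rewrite hnorm_ge0 mul1r /=.
by rewrite opprD addrACA ler_hnormD.
Qed.

Lemma hcvg_le u l (c : R) : hcvg u l -> (forall n, hnorm (u n) <= c) ->
  hnorm l <= c.
Proof.
move=> ul uc; rewrite -subr_le0; apply: (cvg0_le ul) => n.
rewrite lerBlDr -[X in hnorm X](subrK (u n)).
by rewrite (le_trans (ler_hnormD _ _))// hdistC lerD2l.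
Qed.

Lemma hcvg_rinner u l y : hcvg u l ->
  rinner (u n) y @[n --> \oo] --> rinner l y.
Proof.
move=> ul; apply: (cvg_sub0 _ (cvg_cst _)); apply/norm_cvg0P.
apply: (cvg0_squeeze (K := hnorm y) ul) => n /=.
by rewrite normr_ge0 /= !fctE -rinnerBl mulrC ler_norm_rinner.
Qed.

Lemma hcvg_unique u l m : hcvg u l -> hcvg u m -> l = m.
Proof.
move=> ul um; apply: rinner_ext => z.
rewrite -(cvg_lim (@Rhausdorff R) (hcvg_rinner (y := z) ul)).
by rewrite -(cvg_lim _ (hcvg_rinner (y := z) um)).
Qed.

Lemma hcvg_ext u v l : hcvg u l -> (forall n, u n = v n) -> hcvg v l.
Proof. by move=> ul /funext <-. Qed.

Lemma hcvg_lipschitz u l (g : H -> H) (K : R) : hcvg u l ->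
  (forall x y, hnorm (g x - g y) <= K * hnorm (x - y)) ->
  hcvg (fun n => g (u n)) (g l).
Proof.
move=> ul gK; rewrite /hcvg; apply: (cvg0_squeeze (K := K) ul) => n /=.
by rewrite hnorm_ge0 gK.
Qed.

Lemma hcvgZ a u l : hcvg u l -> hcvg (fun n => a *: u n) (a *: l).
Proof.
move=> ul.
apply: (hcvg_lipschitz (K := Num.sqrt (csq a)) (g := *:%R a) ul) => x y.
rewrite -scalerBr.
rewrite -(@ler_pXn2r _ 2) ?nnegrE ?mulr_ge0 ?sqrtr_ge0 ?hnorm_ge0//.
by rewrite hnorm_sqrZ exprMn sqr_sqrtr// addr_ge0 ?sqr_ge0.
Qed.

End VectorLimits.

Section BoundedOperatorTheory.
Context (R : realType) (H : hilbertType R).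
Implicit Types (x y z : H) (A B : 'B(H)) (a : R[i]).

Lemma bop_linear A : linear A.
Proof. by case: A => f /= /asboolP[]. Qed.

Lemma bopD A x y : A (x + y) = A x + A y.
Proof. by have := bop_linear A 1 x y; rewrite !scale1r. Qed.

Lemma bop0 A : A 0 = 0.
Proof. by apply: (@addrI _ (A 0)); rewrite -bopD !addr0. Qed.

Lemma bopZ A a x : A (a *: x) = a *: A x.
Proof. by have := bop_linear A a x 0; rewrite bop0 !addr0. Qed.

Lemma bopN A x : A (- x) = - A x.
Proof. by rewrite -scaleN1r bopZ scaleN1r. Qed.

Lemma bopB A x y : A (x - y) = A x - A y.
Proof. by rewrite bopD bopN. Qed.

Lemma bop_bounded A :
  exists2 M : R, 0 < M & forall x, hnorm (A x) <= M * hnorm x.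
Proof.
case: A => f /= /asboolP[_ [M fM]]; exists (`|M| + 1).
  by rewrite ltr_pwDr.
move=> x; have := fM x; rewrite !normE -rmorphM lecR => /le_trans; apply.
by rewrite ler_wpM2r ?hnorm_ge0// (le_trans (ler_norm M))// lerDl.
Qed.

Lemma bop_ext A B : (forall x, A x = B x) -> A = B.
Proof. by move=> AB; apply/val_inj/funext. Qed.

Lemma bop_exists (f : H -> H) (M : R) : linear f ->
  (forall x, hnorm (f x) <= M * hnorm x) ->
  exists A : 'B(H), forall x, A x = f x.
Proof.
move=> lf fM; have fP : f \in bopP H.
  by apply/asboolP; split=> //; exists M => x; rewrite !normE -rmorphM lecR.
by exists (Bop fP).
Qed.

Lemma bop_hcvg A u x : hcvg u x -> hcvg (fun n => A (u n)) (A x).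
Proof.
move=> ux; have [M _ AM] := bop_bounded A.
apply: (hcvg_lipschitz (K := M) ux) => y z.
by rewrite -bopB.
Qed.

Lemma bop_limit (u : nat -> 'B(H)) (M : R) :
    (forall n x, hnorm (u n x) <= M * hnorm x) ->
    (forall x, exists l, hcvg (fun n => u n x) l) ->
  exists2 A : 'B(H), (forall x, hnorm (A x) <= M * hnorm x) &
    forall x, hcvg (fun n => u n x) (A x).
Proof.
move=> uM /choice[f uf].
have fM x : hnorm (f x) <= M * hnorm x by exact: (hcvg_le (uf x)).
have lf : linear f.
  move=> a x y; apply: (hcvg_unique (uf _)).
  apply: hcvg_ext (hcvgD (hcvgZ a (uf x)) (uf y)) _ => n.
  by rewrite bopD bopZ.
have [A Af] := bop_exists lf fM.
by exists A => x; rewrite Af.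
Qed.

End BoundedOperatorTheory.

(** * Orthonormal bases, Riesz representation and adjoints *)

Section OrthonormalBasis.
Context (R : realType) (H : hilbertType R).
Implicit Types (e x y z : H) (D : set H).

Lemma onbP : orthonormal_basis (@onb R H).
Proof.
pose orthonormal D := (forall e, D e -> inner e e = 1) /\
  (forall e f, D e -> D f -> e <> f -> inner e f = 0).
have [F FP Ftot|D [[D1 D0] Dmax]] := @Zorn_bigcup _ orthonormal.
  split=> [e [X FX Xe]|e f [X FX Xe] [Y FY Yf] ef]; first exact: (FP X FX).1.
  by have [XY|YX] := Ftot _ _ FX FY; [apply: (FP Y FY).2 => //; exact: XY|
    apply: (FP X FX).2 => //; exact: YX].
have DP : orthonormal_basis D.
  split=> // x Dx; apply: contrapT => x0.
  have hx : hnorm x != 0 by apply: contra_notN x0 => /eqP/hnorm_eq0.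
  (* A nonzero vector orthogonal to [D], once normalised, would enlarge [D] against its
     maximality. *)
  pose y := ((hnorm x)^-1)%:C *: x.
  have yy : inner y y = 1.
    rewrite inner_normE hnormZ ger0_norm ?invr_ge0 ?hnorm_ge0//.
    by rewrite mulVf// expr1n.
  have Dy e : D e -> inner e y = 0 by move=> /Dx ex; rewrite innerZr ex mulr0.
  have yD e : D e -> inner y e = 0 by move=> /Dy ey; rewrite innerC ey conjc0.
  apply: (Dmax (D `|` [set y])).
    split; first exact: subsetUl.
    move=> /(_ y (or_intror erefl)) /Dy; rewrite yy => /eqP.
    by rewrite oner_eq0.
  split=> [e [/D1//|->//]|e f [De|->] [Df|->] ef //]; first exact: D0.
  - exact: Dy.
  - exact: yD.
exact: (xgetPex _ (ex_intro _ D DP)).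
Qed.

(** Distinct basis vectors are at distance sqrt 2, so points of the dense set chosen within 1/2 of
    them are distinct. *)
Lemma onb_countable : separable H -> countable (@onb R H).
Proof.
move=> [D [/countable_injP[g gD] dD]]; have [b1 b0 _] := onbP.
have near_pt e : exists d, D d /\ hnorm (e - d) < 2^-1.
  have [||d [/= ed Dd]] := dD (ball e (2^-1)%:C).
  - by exists e; apply: ballxx; rewrite ltcR.
  - by apply: ball_open; rewrite ltcR.
  - by exists d; split=> //; move: ed; rewrite -ball_normE /= normE ltcR.
have [d dP] := choice near_pt.
apply/countable_injP; exists (g \o d) => e f /set_mem eB /set_mem fB /= gef.
have {gef}def : d e = d f.
  by apply: gD gef; apply/mem_set; [exact: (dP e).1|exact: (dP f).1].
apply: contrapT => ef.
have : hnorm (e - f) < 1.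
  rewrite (splitr 1) mul1r -(subrK (d e) e) -addrA.
  rewrite (le_lt_trans (ler_hnormD _ _))// ltrD ?(dP e).2//.
  by rewrite hdistC def (dP f).2.
rewrite -(@ltr_pXn2r _ 2) ?nnegrE ?hnorm_ge0// hnorm_sqrB -!rinnerxx /rinner.
by rewrite (b0 e f)// (b1 e)// (b1 f)//= expr1n; lra.
Qed.

(* An enumeration of the fixed basis by [nat], padded with zero vectors. *)
Definition onb_enum (E : nat -> H) : Prop :=
  [/\ forall n, E n = 0 \/ inner (E n) (E n) = 1,
      forall m n, m <> n -> inner (E m) (E n) = 0,
      forall x, (forall n, inner (E n) x = 0) -> x = 0 &
      forall a : H -> \bar R, (forall x, 0 <= a x)%E -> a 0 = 0%E ->
        (\esum_(e in @onb R H) a e = \sum_(0 <= n <oo) a (E n))%E].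

Lemma onb_enum_exists : separable H -> exists E, onb_enum E.
Proof.
move=> /onb_countable/countable_injP[g gI]; have [b1 b0 bT] := onbP.
(* The default 0 is taken at every n that codes no basis vector; it keeps orthogonality, and
   [a 0 = 0] removes it from the sums. *)
pose E n : H := xget 0 [set e | onb e /\ g e = n].
have EP n : (onb (E n) /\ g (E n) = n) \/
    (E n = 0 /\ ~ (g @` @onb R H) n).
  rewrite /E; case: xgetP => [e _ []|nE]; [by left|right; split=> //].
  by move=> [e eB gen]; exact: (nE e).
have EgK e : onb e -> E (g e) = e.
  move=> eB; have [[EB gE]|[_ []]] := EP (g e); last by exists e.
  by apply: gI gE; exact/mem_set.
exists E; split.
- by move=> n; have [[/b1]|[]] := EP n; [right|left].
- move=> m n mn; have [[mB gm]|[-> _]] := EP m; last first.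
    by rewrite innerC -(scale0r 0) innerZr mul0r conjc0.
  have [[nB gn]|[-> _]] := EP n; last by rewrite -(scale0r 0) innerZr mul0r.
  by apply: b0 => // Emn; apply: mn; rewrite -gm -gn Emn.
- by move=> x Ex; apply: bT => e eB; rewrite -(EgK _ eB).
- move=> a a_ge0 a0; rewrite nneseries_esumT//.
  rewrite (@reindex_esum _ _ _ (g @` @onb R H) _ E); last first.
    split=> [_ [e eB <-]|m n /set_mem [e eB <-] /set_mem [f fB <-]|e eB].
    + by rewrite EgK.
    + by rewrite !EgK// => ->.
    + by exists (g e); [exists e|exact: EgK].
  rewrite esum_mkcond; apply: eq_esum => n _; case: ifPn => // /negP gn.
  have [[EB gE]|[-> _]//] := EP n.
  by case: gn; apply/mem_set; rewrite -gE; exists (E n).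
Qed.

End OrthonormalBasis.

Section OrthonormalExpansion.
Context (R : realType) (H : hilbertType R) (E : nat -> H).
Hypothesis E_enum : onb_enum E.
Implicit Types (x y z : H) (c : nat -> R[i]).

Let osum c N : H := \sum_(0 <= k < N) c k *: E k.
Let sqsum c N : R := \sum_(0 <= k < N) csq (c k).
(** At a padding index the inner product with [E k] is 0, so only coefficients that vanish there can
    be recovered from the sum. *)
Let supported c := forall k, E k = 0 -> c k = 0.

Let innerE_osum c k N : supported c ->
  inner (E k) (osum c N) = if (k < N)%N then c k else 0.
Proof.
have [E1 E0 _ _] := E_enum; move=> c0; elim: N => [|N IH].
  by rewrite /osum big_nil inner0r.
rewrite /osum big_nat_recr//= innerDr IH innerZr ltnS [in RHS]leq_eqVlt.
have [->|/eqP kN] := eqVneq k N.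
  rewrite ltnn add0r; have [EN|->] := E1 N; last by rewrite mulr1.
  by rewrite EN inner0r mulr0 c0.
by rewrite (E0 k N)// mulr0 addr0.
Qed.

Let sqsumS c N : sqsum c N.+1 = sqsum c N + csq (c N).
Proof. by rewrite /sqsum big_nat_recr. Qed.

Let sqsum_homo c : {homo sqsum c : m n / (m <= n)%N >-> m <= n}.
Proof.
apply: homo_leq => [//|m n p|n]; first exact: le_trans.
by rewrite sqsumS lerDl csq_ge0.
Qed.

(** Pythagoras, in the form that [hilbert_complete] takes as input. *)
Let hnorm_osumB c M N : supported c -> (M <= N)%N ->
  hnorm (osum c N - osum c M) ^+ 2 = sqsum c N - sqsum c M.
Proof.
have [E1 _ _ _] := E_enum; move=> c0 /subnK <-.
elim: (N - M)%N => [|k IH]; first by rewrite add0n !subrr hnorm0 expr0n.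
rewrite addSn sqsumS /osum big_nat_recr//= -/(osum c _) -/(osum c _).
have orth : inner (E (k + M)%N) (osum c (k + M) - osum c M) = 0.
  rewrite innerBr !innerE_osum// ltnn ltnNge leq_addl subr0 //.
rewrite addrAC hnorm_sqrD IH hnorm_sqrZ.
move: (osum c (k + M) - osum c M) orth => w orth.
rewrite {1}/rinner innerZr innerC orth conjc0 mulr0 mulr0 addr0.
rewrite -rinnerxx /rinner; have [E00|->] := E1 (k + M)%N.
  by rewrite E00 c0// inner0r /csq /= expr0n /=; ring.
by rewrite /= mulr1; ring.
Qed.

Let hnorm_osum c N : supported c -> hnorm (osum c N) ^+ 2 = sqsum c N.
Proof.
move=> c0; rewrite -[osum c N]subr0 -[sqsum c N]subr0.
by have := hnorm_osumB c0 (leq0n N); rewrite /osum /sqsum !big_nil.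
Qed.

(** Riesz-Fischer: bounded partial sums of squares converge by monotonicity, and so do the
    vectors. *)
Let osum_cvg c (K : R) : supported c -> (forall N, sqsum c N <= K) ->
  exists2 v, hcvg (osum c) v & forall k, inner (E k) v = c k.
Proof.
move=> c0 cK.
have cs : cvgn (sqsum c).
  apply: nondecreasing_is_cvgn; first exact: sqsum_homo.
  by exists K => _ [N _ <-].
have [m n mn|v vP] := @hilbert_complete _ _ (osum c) _ cs.
  by rewrite hnorm_osumB// ler_norm.
(* Against [E k] the partial sums are constant from index k+1 on, so the limit has that same
   value. *)
exists v => // k; have lim_near z (a : R) :
    (forall N, (k < N)%N -> rinner (osum c N) z = a) -> rinner v z = a.
  move=> za; have := hcvg_rinner (y := z) vP.
  rewrite -(cvg_shiftn k.+1) => /(cvg_lim (@Rhausdorff R)) <-.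
  rewrite (_ : (fun _ => _) = cst a) ?lim_cst//.
  by apply/funext => N /=; rewrite za// addnS ltnS leq_addl.
rewrite innerE !(rinnerC _ v) (@lim_near _ (complex.Re (c k))) => [|N kN].
  rewrite (@lim_near _ (complex.Im (c k))) => [|N kN]; first by case: (c k).
  rewrite rinnerC /rinner innerZl innerE_osum// kN.
  by case: (c k) => a b /=; ring.
by rewrite rinnerC /rinner innerE_osum// kN.
Qed.

Let coef_supported x : supported (fun k => inner (E k) x).
Proof. by move=> k ->; rewrite inner0l. Qed.

Let rinner_osum x N :
  rinner x (osum (fun k => inner (E k) x) N) = sqsum (fun k => inner (E k) x) N.
Proof.
elim: N => [|N IH]; first by rewrite /osum /sqsum !big_nil rinner0r.
rewrite sqsumS /osum big_nat_recr//= rinnerDr IH; congr (_ + _).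
rewrite /rinner innerZr (innerC x) /csq; case: (inner _ x) => a b /=; ring.
Qed.

Let hnorm_coefB x N : hnorm (x - osum (fun k => inner (E k) x) N) ^+ 2 =
  hnorm x ^+ 2 - sqsum (fun k => inner (E k) x) N.
Proof.
rewrite hnorm_sqrB rinner_osum hnorm_osum; last exact: coef_supported.
by ring.
Qed.

(** By Bessel's inequality the expansion converges to some v; then x - v is orthogonal to the whole
    basis, hence 0. *)
Lemma onb_expansion x :
  hcvg (fun N => \sum_(0 <= k < N) inner (E k) x *: E k) x.
Proof.
have [_ _ ET _] := E_enum.
have [N|v vP vE] := osum_cvg (K := hnorm x ^+ 2) (coef_supported x).
  by rewrite -subr_ge0 -hnorm_coefB sqr_ge0.
suff -> : x = v.
  by apply: hcvg_ext vP _ => N; rewrite /osum; under eq_bigr do rewrite -vE.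
by apply/subr0_eq/ET => k; rewrite -scaleN1r innerDr innerZr vE mulN1r subrr.
Qed.

Lemma parseval x :
  (\sum_(0 <= k <oo) (csq (inner (E k) x))%:E = (hnorm x ^+ 2)%:E)%E.
Proof.
apply: cvg_lim => //; apply: (@cvg_trans _ ((fun N =>
  (sqsum (fun k => inner (E k) x) N)%:E) @ \oo)).
  by apply: near_eq_cvg; apply: nearW => N; rewrite sumEFin.
apply: cvg_EFin; first exact: nearW.
have /(hcvg_rinner (y := x)) := onb_expansion x.
rewrite rinnerxx (_ : (fun _ => _) = sqsum (fun k => inner (E k) x)) //.
by apply/funext => N; rewrite rinnerC rinner_osum.
Qed.

Lemma riesz (phi : H -> R[i]) (M : R) :
    (forall (a : R[i]) x y, phi (a *: x + y) = a * phi x + phi y) ->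
    (forall x, complex.Re (phi x) <= M * hnorm x) ->
  exists y, forall x, phi x = inner y x.
Proof.
have [E1 _ _ _] := E_enum; move=> lphi phiM.
have phiD x y : phi (x + y) = phi x + phi y.
  by have := lphi 1 x y; rewrite scale1r mul1r.
have phi0 : phi 0 = 0 by apply: (@addrI _ (phi 0)); rewrite -phiD !addr0.
have phiZ a x : phi (a *: x) = a * phi x.
  by have := lphi a x 0; rewrite !addr0 phi0 addr0.
(* These are the coefficients that the representing vector must have. Testing [phi] on their own
   partial sums gives |v|^2 <= M |v| for each partial sum v, hence the bound [M ^+ 2]. *)
pose c k := conjc (phi (E k)).
have c0 : supported c by move=> k Ek; rewrite /c Ek phi0 conjc0.
have phi_osum N : complex.Re (phi (osum c N)) = sqsum c N.
  elim: N => [|N IH]; first by rewrite /osum /sqsum !big_nil phi0.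
  rewrite sqsumS /osum big_nat_recr//= phiD raddfD /= IH phiZ /c /csq.
  by case: (phi (E N)) => a b /=; ring.
have [N|y _ yE] := osum_cvg (K := M ^+ 2) c0.
  have := phiM (osum c N); rewrite phi_osum -hnorm_osum//.
  have := hnorm_ge0 (osum c N); nra.
exists y.
(* [psi] vanishes on all finite sums, so its one-sided bound, applied to the remainder of the
   expansion of x, gives Re psi <= 0 in the limit. The substitutions -x and ix then give psi = 0. *)
pose psi x := phi x - inner y x.
have psiD x z : psi (x + z) = psi x + psi z.
  by rewrite /psi phiD innerDr; ring.
have psiZ a x : psi (a *: x) = a * psi x.
  by rewrite /psi phiZ innerZr; ring.
have psi0 x : complex.Re (psi x) <= 0.
  have psi_osum b N : psi (osum b N) = 0.
    elim: N => [|N IH]; first by rewrite /osum big_nil /psi phi0 inner0r subrr.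
    rewrite /osum big_nat_recr//= psiD IH psiZ /psi innerC yE /c conjcK.
    by rewrite subrr mulr0 addr0.
  have xE := onb_expansion x.
  have KE : (fun N => (M + hnorm y) *
      hnorm (osum (fun k => inner (E k) x) N - x)) @ \oo --> (0 : R).
    by rewrite -(mulr0 (M + hnorm y)); exact: cvgMl_tmp.
  apply: (cvg0_le KE) => N; rewrite hdistC.
  rewrite -[in leLHS](subrK (osum (fun k => inner (E k) x) N) x).
  rewrite psiD psi_osum addr0 /psi raddfB /= mulrDl lerD//.
  rewrite -/(rinner y _) -rinnerNr; set d := x - _.
  by rewrite -(hnorm_opp d) ler_rinner.
have Re_psi x : complex.Re (psi x) = 0.
  apply/le_anti; rewrite psi0 /= -oppr_le0.
  by have := psi0 ((-1) *: x); rewrite psiZ mulN1r raddfN.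
move=> x; apply/subr0_eq; rewrite -/(psi x).
have := Re_psi x; have := Re_psi ('i *: x); rewrite psiZ.
case: (psi x) => a b /= + ->; rewrite mul0r sub0r mul1r => /eqP.
by rewrite oppr_eq0 => /eqP ->.
Qed.

End OrthonormalExpansion.

Section Adjoint.
Context (R : realType) (H : hilbertType R).
Hypothesis H_sep : separable H.
Implicit Types (x y z : H) (A B : 'B(H)).

Lemma inner_ext x y : (forall z, inner x z = inner y z) -> x = y.
Proof. by move=> xy; apply: rinner_ext => z; rewrite /rinner xy. Qed.

Lemma bop_adjP A x y : inner (bop_adj A x) y = inner x (A y).
Proof.
suff : exists B : 'B(H), forall x y, inner (B x) y = inner x (A y).
  case=> B BA; exact: (@xgetPex _ 0
    [set C : 'B(H) | forall x y, inner (C x) y = inner x (A y)]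
    (ex_intro _ B BA)).
have [E E_enum] := onb_enum_exists H_sep.
have [M M0 AM] := bop_bounded A.
have [|B BA] := choice (P := fun u v => forall z, inner u (A z) = inner v z).
  move=> u; apply: (@riesz _ _ E E_enum (fun z => inner u (A z)) (M * hnorm u)).
    by move=> a v w; rewrite bopD bopZ innerDr innerZr.
  move=> v; rewrite (le_trans (ler_rinner _ _))//.
  by rewrite (mulrC M) -mulrA ler_wpM2l ?hnorm_ge0.
have lB : linear B.
  move=> a u v; apply: inner_ext => z.
  by rewrite innerDl innerZl -!BA innerDl innerZl.
have BM u : hnorm (B u) <= M * hnorm u.
  (* |Bu|^2 = <u, A(Bu)>, so the bound of [A] carries over to [B] after division by |Bu|. *)
  have : hnorm (B u) ^+ 2 <= M * hnorm u * hnorm (B u).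
    rewrite -rinnerxx /rinner -BA (le_trans (ler_rinner _ _))//.
    by rewrite (mulrC M) -mulrA ler_wpM2l ?hnorm_ge0.
  have [->|Bu0] := eqVneq (hnorm (B u)) 0.
    by move=> _; rewrite mulr_ge0 ?hnorm_ge0 ?ltW.
  by rewrite expr2 ler_pM2r// lt_neqAle eq_sym Bu0 hnorm_ge0.
have [B' B'E] := bop_exists lB BM.
by exists B' => u v; rewrite B'E BA.
Qed.

End Adjoint.

(** * Positive operators, square roots and polar decomposition *)

Section OperatorLaws.
Context (R : realType) (H : hilbertType R).
Implicit Types (x y : H) (A B : 'B(H)) (a : R[i]).

Lemma bopDE A B x : (A + B) x = A x + B x. Proof. by []. Qed.
Lemma bopNE A x : (- A) x = - A x. Proof. by []. Qed.
Lemma bopZE a A x : (a *: A) x = a *: A x. Proof. by []. Qed.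
Lemma bop0E x : (0 : 'B(H)) x = 0. Proof. by []. Qed.

(** Real parts suffice: since [A] is complex linear, [symmetric_inner] recovers the imaginary part
    through ['i *: x]. *)
Definition symmetric_op A := forall x y, rinner (A x) y = rinner x (A y).

Lemma rinnerNi x y : rinner ('i *: x) y = - rinner x ('i *: y).
Proof.
by rewrite /rinner innerZl innerZr; case: (inner x y) => a b /=; ring.
Qed.

Lemma pos_rinner_ge0 A x : bop_pos A -> 0 <= rinner x (A x).
Proof. by move=> /(_ x); rewrite lecE => /andP[]. Qed.

Lemma pos_symmetric A : bop_pos A -> symmetric_op A.
Proof.
move=> A0; have im0 x : rinner ('i *: x) (A x) = 0.
  by have /ger0_Im := A0 x; rewrite innerE.
(* Polarization: the form has no imaginary part at x + iy either, and its cross terms are the two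
   sides of the symmetry. *)
move=> x y; have := im0 (x + 'i *: y).
rewrite bopD bopZ scalerDr !rinnerDl !rinnerDr !im0 rinnerii.
rewrite (rinnerNi _ (A x)) !rinnerii im0 add0r addr0 => /eqP.
by rewrite subr_eq0 => /eqP ->; rewrite rinnerC.
Qed.

Lemma symmetric_pos A : symmetric_op A ->
  (forall x, 0 <= rinner x (A x)) -> bop_pos A.
Proof.
move=> sA A0 x; rewrite innerE lecE /= A0 andbT.
have : rinner ('i *: x) (A x) = - rinner ('i *: x) (A x).
  by rewrite {1}rinnerNi -bopZ -sA rinnerC.
by move=> h; apply/eqP; lra.
Qed.

Lemma symmetric_inner A x y : symmetric_op A ->
  inner (A x) y = inner x (A y).
Proof. by move=> sA; rewrite !innerE sA -bopZ sA. Qed.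

End OperatorLaws.

Section SquareRoot.
Context (R : realType) (H : hilbertType R) (C : 'B(H)).
Hypothesis C_sym : symmetric_op C.
Hypothesis C_contr : forall x, hnorm (C x) <= hnorm x.
Implicit Types (x y : H).

(* The scalar recursion [c] dominates the operator recursion [Q]: both
   [|Q n|] and [|Q n.+1 - Q n|] are bounded by their counterparts for [c]. *)
Let c n : R := iter n (fun t => 2^-1 * (1 + t ^+ 2)) 0.
Let Q n : 'B(H) := iter n (fun T => (2^-1)%:C *: (C + T ** T)) 0.

Let c_bound n : 0 <= c n <= 1.
Proof. by elim: n => [|n]; rewrite /c ?lexx ?ler01//= -/(c n); nra. Qed.

Let c_homo : {homo c : m n / (m <= n)%N >-> m <= n}.
Proof.
apply: homo_leq => [//|m n p|n]; first exact: le_trans.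
by have := sqr_ge0 (c n - 1); rewrite /c /= -/(c n); lra.
Qed.

Let QS n x : Q n.+1 x = (2^-1)%:C *: (C x + Q n (Q n x)).
Proof. by []. Qed.

Let Q_le n x : hnorm (Q n x) <= c n * hnorm x.
Proof.
elim: n x => [|n IH] x; first by rewrite bop0E hnorm0 mul0r.
rewrite QS hnormZ ger0_norm ?invr_ge0// /c /= -/(c n) -mulrA ler_pM2l//.
rewrite (le_trans (ler_hnormD _ _))// mulrDl mul1r lerD//.
rewrite (le_trans (IH _))// expr2 -mulrA ler_wpM2l//.
by have /andP[] := c_bound n.
Qed.

Let Q_comm (T : 'B(H)) n x : (forall y, T (C y) = C (T y)) ->
  T (Q n x) = Q n (T x).
Proof.
move=> TC; elim: n x => [|n IH] x; first by rewrite bop0E bop0.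
by rewrite !QS bopZ bopD TC !IH.
Qed.

Let QQ_comm m n x : Q m (Q n x) = Q n (Q m x).
Proof. by apply: Q_comm => y; rewrite (@Q_comm C). Qed.

Let Q_diff n x : hnorm (Q n.+1 x - Q n x) <= (c n.+1 - c n) * hnorm x.
Proof.
elim: n x => [|n IH] x.
  rewrite QS !bop0E addr0 subr0 hnormZ ger0_norm ?invr_ge0//.
  by rewrite /c /= expr0n /= addr0 mulr1 subr0 ler_pM2l.
(* The iterates commute, so the difference of squares factors through [Q n.+1 - Q n] and
   [Q n.+1 + Q n]; the differences of [c] factor in the same way. *)
have -> : Q n.+2 x - Q n.+1 x = (2^-1)%:C *:
    (Q n.+1 (Q n.+1 x + Q n x) - Q n (Q n.+1 x + Q n x)).
  rewrite [LHS](_ : _ = (2^-1)%:C *: (C x + Q n.+1 (Q n.+1 x)) -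
    (2^-1)%:C *: (C x + Q n (Q n x))); last by rewrite -!QS.
  rewrite -scalerBr !bopD (QQ_comm n.+1 n); congr (_ *: _).
  by rewrite opprD addrACA subrr add0r opprD addrA addrK.
rewrite hnormZ ger0_norm ?invr_ge0//.
have cc : c n <= c n.+1 by exact: c_homo.
have -> : c n.+2 - c n.+1 = 2^-1 * ((c n.+1 - c n) * (c n.+1 + c n)).
  by rewrite {1 2}/c /= -/(c n) -/(c n.+1) /c /= -/(c n); field.
rewrite -mulrA ler_pM2l// (le_trans (IH _))// -mulrA ler_wpM2l ?subr_ge0//.
by rewrite (le_trans (ler_hnormD _ _))// mulrDl lerD.
Qed.

Let Q_dist m n x : (m <= n)%N ->
  hnorm (Q n x - Q m x) <= (c n - c m) * hnorm x.
Proof.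
move=> /subnK <-; elim: (n - m)%N => [|k IH].
  by rewrite add0n !subrr hnorm0 mul0r.
rewrite addSn -(subrK (Q (k + m) x) (Q _.+1 x)) -addrA.
rewrite (le_trans (ler_hnormD _ _))// -(subrK (c (k + m)) (c _.+1)) -addrA.
by rewrite mulrDl lerD.
Qed.

Let Q_sym n : symmetric_op (Q n).
Proof.
elim: n => [|n IH] x y; first by rewrite !bop0E rinner0l rinner0r.
by rewrite !QS rinnerZl rinnerZr rinnerDl rinnerDr C_sym !IH.
Qed.

(** A limit T of the iterates satisfies T = (C + T^2)/2, that is (1 - T)^2 = 1 - C. The root is 1 -
    T, positive because T is a symmetric contraction. *)
Lemma sqrt_one_minus : exists T : 'B(H),
  bop_pos T /\ forall x, T (T x) = x - C x.
Proof.
have [n x|x|T T1 QT] := @bop_limit _ _ Q 1.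
- rewrite (le_trans (Q_le _ _))// ler_wpM2r ?hnorm_ge0//.
  by have /andP[] := c_bound n.
- have [|m n mn|l Ql] := @hilbert_complete _ _ (fun n => Q n x)
      (fun n => c n * hnorm x ^+ 2); last by exists l.
    apply: nondecreasing_is_cvgn.
      by move=> m n mn; rewrite ler_wpM2r ?sqr_ge0// c_homo.
    exists (hnorm x ^+ 2) => _ [n _ <-]; rewrite ler_piMl ?sqr_ge0//.
    by have /andP[] := c_bound n.
  have cc := c_homo mn.
  rewrite -mulrBl normrM !ger0_norm ?sqr_ge0 ?subr_ge0//.
  have := Q_dist x mn; have := hnorm_ge0 (Q n x - Q m x).
  have /andP[_ cn1] := c_bound n; have /andP[cm0 _] := c_bound m.
  move=> h0 h1; apply: (@le_trans _ _ (((c n - c m) * hnorm x) ^+ 2)).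
    by rewrite ler_pXn2r ?nnegrE ?mulr_ge0 ?subr_ge0 ?hnorm_ge0.
  (* The difference [c n - c m] lies in [0, 1], so its square is at most itself. *)
  rewrite exprMn ler_wpM2r ?sqr_ge0// expr2 ler_piMl ?subr_ge0//; lra.
have TT x : T x = (2^-1)%:C *: (C x + T (T x)).
  (* Strong limits pass to this product because the [Q n] are uniformly bounded: [Q n] applied to
     [Q n x - T x] tends to 0. *)
  have QQ : hcvg (fun n => Q n (Q n x)) (T (T x)).
    have Q0 : hcvg (fun n => Q n (Q n x - T x)) 0.
      apply: (cvg0_squeeze (K := 1) (QT x)) => n; rewrite subr0 hnorm_ge0 /=.
      rewrite (le_trans (Q_le _ _))// ler_wpM2r ?hnorm_ge0//.
      by have /andP[] := c_bound n.
    have := hcvgD Q0 (QT (T x)); rewrite add0r => /hcvg_ext; apply=> n.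
    by rewrite bopB subrK.
  have := QT x; rewrite /hcvg -cvg_shiftS => /hcvg_unique; apply.
  exact: hcvgZ (hcvgD (hcvg_cst (C x)) QQ).
have sT : symmetric_op T.
  move=> x y; have := hcvg_rinner (y := x) (QT y).
  rewrite (rinnerC x) => /(cvg_lim (@Rhausdorff R)) <-.
  have /(cvg_lim (@Rhausdorff R)) <- := hcvg_rinner (y := y) (QT x).
  rewrite (_ : (fun n => _) = (fun n => rinner (Q n y) x)) //.
  by apply/funext => n; rewrite Q_sym rinnerC.
have [S SE] : exists S : 'B(H), forall x, S x = x - T x.
  by exists (bop_id H - T).
exists S; split.
  apply: symmetric_pos => [x y|x].
    by rewrite !SE rinnerBl rinnerBr sT.
  rewrite SE rinnerBr rinnerxx subr_ge0 (le_trans (ler_rinner _ _))//.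
  by rewrite expr2 ler_wpM2l ?hnorm_ge0// -[leRHS]mul1r.
move=> x; rewrite !SE bopB.
have : T x + T x = C x + T (T x).
  have half : 2^-1 + 2^-1 = 1 :> R by lra.
  rewrite -[RHS]scale1r -(rmorph1 (real_complex R)) -half rmorphD scalerDl.
  by rewrite -TT.
move=> TC; have -> : C x = T x + T x - T (T x) by rewrite TC addrK.
by rewrite !opprB opprD -addrA; congr (_ + _); rewrite addrC -addrA.
Qed.

End SquareRoot.

Section Positive.
Context (R : realType) (H : hilbertType R).
Implicit Types (x y : H) (A P : 'B(H)).

(** This is P^2 <= P. Positivity at x - Px gives 2|Px|^2 <= <x,Px> + <Px,PPx>, and the last term is
    at most |Px|^2. *)
Lemma pos_contraction_le P x : bop_pos P ->
  (forall x, hnorm (P x) <= hnorm x) -> hnorm (P x) ^+ 2 <= rinner x (P x).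
Proof.
move=> P0 P1; have := pos_rinner_ge0 (x - P x) P0.
rewrite bopB rinnerBl !rinnerBr -!rinnerxx (pos_symmetric P0).
have := ler_rinner (P x) (P (P x)); have := P1 (P x).
rewrite -(pos_symmetric P0 x (P x)) rinnerxx.
by have := hnorm_ge0 (P x); have := hnorm_ge0 (P (P x)); nra.
Qed.

Lemma pos_scale (r : R) P : 0 <= r -> bop_pos P -> bop_pos (r%:C *: P).
Proof. by move=> r0 P0 x; rewrite bopZE innerZr mulr_ge0// ler0c. Qed.

Lemma pos_rescale P : bop_pos P -> exists r : R, [/\ 0 < r,
  bop_pos (r%:C *: P) & forall x, hnorm ((r%:C *: P) x) <= hnorm x].
Proof.
have [M M0 PM] := bop_bounded P; move=> P0; exists M^-1.
split=> [||x]; first by rewrite invr_gt0.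
  by apply: pos_scale; rewrite ?invr_ge0 ?ltW.
by rewrite bopZE hnormZ gtr0_norm ?invr_gt0// ler_pdivrMl.
Qed.

Lemma one_minus_sym P : bop_pos P -> symmetric_op (bop_id H - P).
Proof.
by move=> P0 x y; rewrite !bopDE rinnerDl rinnerDr !bopNE rinnerNl rinnerNr
  (pos_symmetric P0).
Qed.

Lemma one_minus_contraction P x : bop_pos P ->
  (forall x, hnorm (P x) <= hnorm x) -> hnorm ((bop_id H - P) x) <= hnorm x.
Proof.
move=> P0 P1; rewrite -(@ler_pXn2r _ 2)// ?nnegrE ?hnorm_ge0//.
rewrite bopDE bopNE hnorm_sqrB /=.
have := pos_contraction_le x P0 P1; have := pos_rinner_ge0 x P0; lra.
Qed.

(** With rP a contraction, [sqrt_one_minus] is applied to C = 1 - rP; the factor [Num.sqrt r^-1]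
    undoes the rescaling. *)
Lemma pos_sqrt P : bop_pos P -> exists T, bop_pos T /\ T ** T = P.
Proof.
move=> P0; have [r [r0 rP0 rP1]] := pos_rescale P0.
have [T [T0 TT]] := sqrt_one_minus (one_minus_sym rP0)
  (fun x => one_minus_contraction x rP0 rP1).
exists ((Num.sqrt r^-1)%:C *: T); split.
  by apply: pos_scale => //; exact: sqrtr_ge0.
apply: bop_ext => x; set s := Num.sqrt _.
rewrite -[LHS]/(s%:C *: T (s%:C *: T x)) bopZ scalerA -rmorphM /=.
rewrite -expr2 sqr_sqrtr ?invr_ge0 ?ltW// TT bopDE bopNE -[(bop_id H) x]/x.
rewrite opprB addrCA subrr addr0 bopZE scalerA -rmorphM mulVf ?gt_eqF//.
by rewrite rmorph1 scale1r.
Qed.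

End Positive.

Section Polar.
Context (R : realType) (H : hilbertType R) (A P : 'B(H)).
Hypothesis P_pos : bop_pos P.
Hypothesis PA : forall x, hnorm (A x) = hnorm (P x).
Implicit Types (x y : H).

(* [W] is the strong limit of [a q_n(p)], where [p] and [a] are rescalings of
   [P] and [A], and [q_n(t)] is the sum of [(1 - t) ^ k] for [k < n], so that
   [t * q_n(t) = 1 - (1 - t) ^ n]. *)
Lemma polar : exists2 W : 'B(H),
  (forall x, hnorm (W x) <= 2 * hnorm x) & forall x, W (P x) = A x.
Proof.
have [r [r0 p0 p1]] := pos_rescale P_pos.
pose p := r%:C *: P; pose a := r%:C *: A; pose C := bop_id H - p.
have pa x : hnorm (a x) = hnorm (p x) by rewrite !bopZE !hnormZ PA.
have CE x : C x = x - p x by [].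
have Csym : symmetric_op C by exact: one_minus_sym.
have C1 x : hnorm (C x) <= hnorm x by exact: one_minus_contraction.
pose Cn n : 'B(H) := iter n (bop_comp C) (bop_id H).
have CnS n x : Cn n.+1 x = C (Cn n x) by [].
have CnSr n x : Cn n.+1 x = Cn n (C x).
  by elim: n => // n IH; rewrite CnS IH.
have CnD m n x : Cn (m + n)%N x = Cn m (Cn n x).
  by elim: m => // m IH; rewrite addSn !CnS IH.
have Cn1 n x : hnorm (Cn n x) <= hnorm x.
  by elim: n => // n IH; rewrite CnS (le_trans (C1 _)).
have Cn_sym n : symmetric_op (Cn n).
  by elim: n => // n IH x y; rewrite CnS Csym IH -CnSr.
have Cn_sqr n x : hnorm (Cn n x) ^+ 2 <= rinner x (Cn n x).
  (* Halving the exponent leaves only 1 or C between two equal powers. For C the bound |Cy|^2 <=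
     <y,Cy> follows from p^2 <= p. *)
  have -> : Cn n x = Cn n./2 (Cn (odd n) (Cn n./2 x)).
    by rewrite -[in LHS](odd_double_half n) -addnn addnCA 2!CnD.
  rewrite -Cn_sym; move: (Cn n./2 x) => y.
  apply: (@le_trans _ _ (hnorm (Cn (odd n) y) ^+ 2)).
    by rewrite ler_pXn2r ?nnegrE ?hnorm_ge0.
  case: (odd n); last by rewrite -rinnerxx.
  rewrite -[Cn _ y]/(C y) CE hnorm_sqrB rinnerBr rinnerxx.
  by have := pos_contraction_le y p0 p1; rewrite -/p; lra.
have Cn_dist m n x : (m <= n)%N ->
    hnorm (Cn n x - Cn m x) ^+ 2 <= hnorm (Cn m x) ^+ 2 - hnorm (Cn n x) ^+ 2.
  move=> /subnK <-; rewrite CnD; move: (Cn m x) => y.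
  rewrite hnorm_sqrB rinnerC.
  by have := Cn_sqr (n - m)%N y; lra.
have Cn_homo x : nonincreasing_seq (fun n => hnorm (Cn n x) ^+ 2).
  move=> m n mn; rewrite -subr_ge0 (le_trans _ (Cn_dist _ _ x mn))//.
  exact: sqr_ge0.
have Cn_cauchy x m n : (m <= n)%N -> hnorm (Cn n x - Cn m x) ^+ 2 <=
    `|hnorm (Cn n x) ^+ 2 - hnorm (Cn m x) ^+ 2|.
  move=> mn; rewrite distrC ger0_norm ?Cn_dist//.
  by rewrite subr_ge0; exact: Cn_homo.
have Cn_is_cvg x : cvgn (fun n => hnorm (Cn n x) ^+ 2).
  apply: nonincreasing_is_cvgn (Cn_homo x) _.
  by exists 0 => _ [n _ <-]; exact: sqr_ge0.
pose q n : 'B(H) := iteri n (fun k T => T + Cn k) 0.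
have qS n x : q n.+1 x = q n x + Cn n x by [].
have pq n x : p (q n x) = x - Cn n x.
  elim: n => [|n IH]; first by rewrite bop0E bop0 subrr.
  by rewrite qS bopD IH CnS CE opprB -addrA [in LHS](addrC (- _)).
have qp n x : q n (p x) = x - Cn n x.
  elim: n => [|n IH]; first by rewrite bop0E subrr.
  by rewrite qS IH CnSr CE bopB opprB -addrA [in LHS](addrC (- _)).
(* The operators [q n] need not be uniformly bounded. As |av| = |pv|, only p q_n = 1 - C^n matters,
   which is Cauchy and of norm at most 2. *)
have aq_dist m n x : hnorm (a (q n x) - a (q m x)) = hnorm (Cn n x - Cn m x).
  by rewrite -bopB pa bopB !pq hdistC opprB addrC addrA subrK.
have aq_le n x : hnorm ((a ** q n) x) <= 2 * hnorm x.
  rewrite pa pq (le_trans (ler_hnormD _ _))// hnorm_opp mulrDl mul1r.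
  by rewrite lerD.
have [x|W W2 WE] := bop_limit aq_le.
  apply: (@hilbert_complete _ _ _ (fun n => hnorm (Cn n x) ^+ 2)) => // m n mn.
  by rewrite aq_dist Cn_cauchy.
have Wp x : W (p x) = a x.
  (* The limit l of C^n x is fixed by C, so pl = 0 and hence al = 0. Therefore a q_n(p) p x = a(x -
     C^n x) tends to ax. *)
  have [l Cl] := @hilbert_complete _ _ (fun n => Cn n x) _ (Cn_is_cvg x)
    (Cn_cauchy x).
  have Cll : C l = l.
    apply: (hcvg_unique (bop_hcvg C Cl)).
    by move: Cl; rewrite /hcvg -cvg_shiftS.
  have al : a l = 0.
    have pl : p l = 0.
      by apply/oppr_inj/(@addrI _ l); rewrite oppr0 addr0 -CE.
    by apply: hnorm_eq0; rewrite pa pl hnorm0.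
  have := bop_hcvg a (hcvgD (hcvg_cst x) (hcvgZ (-1) Cl)).
  rewrite bopD bopZ al scaler0 addr0 => /hcvg_unique ax; apply/esym/ax.
  apply: hcvg_ext (WE (p x)) _ => n.
  by rewrite /= qp scaleN1r.
exists W => // x; have := Wp x.
rewrite /p /a !bopZE bopZ => /(congr1 (fun v => (r^-1)%:C *: v)).
by rewrite !scalerA -!rmorphM mulVf ?gt_eqF// rmorph1 !scale1r.
Qed.

End Polar.

(** * Hilbert-Schmidt operators and unitary invariance of trace sums *)

Section HilbertSchmidt.
Context (R : realType) (H : hilbertType R).
Hypothesis H_sep : separable H.
Implicit Types (x y : H) (A B M U X Y Z : 'B(H)).

Definition hs2 Z : \bar R := (\esum_(e in @onb R H) (hnorm (Z e) ^+ 2)%:E)%E.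

Lemma hs2_ge0 Z : (0 <= hs2 Z)%E.
Proof. by apply: esum_ge0 => e _; rewrite lee_fin sqr_ge0. Qed.

Lemma hs2_isometry U Z : (forall x, hnorm (U x) = hnorm x) ->
  hs2 (U ** Z) = hs2 Z.
Proof. by move=> U1; apply: eq_esum => e _; rewrite /= U1. Qed.

Lemma hs2_le (K : R) Z Y : (forall x, hnorm (Z x) <= K * hnorm (Y x)) ->
  (hs2 Z <= (K ^+ 2)%:E * hs2 Y)%E.
Proof.
move=> ZY; have [E [E1 E2 E3 EE]] := onb_enum_exists H_sep.
have a0 (T : 'B(H)) : (hnorm (T 0) ^+ 2)%:E = 0%E :> \bar R.
  by rewrite bop0 hnorm0 expr0n.
rewrite /hs2 !EE//; do ?[by move=> x; rewrite lee_fin sqr_ge0].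
rewrite -nneseriesZl//; last by move=> n _; rewrite lee_fin sqr_ge0.
apply: lee_nneseries => [n _ _|n _]; rewrite ?lee_fin ?sqr_ge0//.
rewrite -exprMn ler_pXn2r ?nnegrE ?hnorm_ge0//.
exact: le_trans (hnorm_ge0 _) (ZY _).
Qed.

(** Parseval turns both sides into double sums of squared matrix entries, which Tonelli
    exchanges. *)
Lemma hs2_adjoint X Z : (forall x y, inner (X x) y = inner x (Z y)) ->
  hs2 X = hs2 Z.
Proof.
move=> XZ; have [E E_enum] := onb_enum_exists H_sep.
have [_ _ _ EE] := E_enum.
have a0 (T : 'B(H)) : (hnorm (T 0) ^+ 2)%:E = 0%E :> \bar R.
  by rewrite bop0 hnorm0 expr0n.
rewrite /hs2 !EE//; do ?[by move=> x; rewrite lee_fin sqr_ge0].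
under eq_eseriesr do rewrite -(parseval E_enum).
under [RHS]eq_eseriesr do rewrite -(parseval E_enum).
rewrite nneseries_interchange; last by move=> *; rewrite lee_fin csq_ge0.
apply: eq_eseriesr => m _; apply: eq_eseriesr => n _; congr EFin.
rewrite innerC XZ /csq; case: (inner _ _) => a b /=; ring.
Qed.

Lemma bop_adjE A x y : inner (A x) y = inner x (bop_adj A y).
Proof. by rewrite innerC -bop_adjP// -innerC. Qed.

(** A right factor cannot be bounded term by term; passing to adjoints makes it a left factor, which
    can. *)
Lemma hs2_comp_le (K : R) X M :
    (forall y, hnorm (bop_adj M y) <= K * hnorm y) ->
  (hs2 (X ** M) <= (K ^+ 2)%:E * hs2 X)%E.
Proof.
move=> MK; rewrite (@hs2_adjoint _ (bop_adj M ** bop_adj X)); last first.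
  by move=> x y /=; rewrite !bop_adjE.
rewrite (@hs2_adjoint X (bop_adj X)); last exact: bop_adjE.
by apply: hs2_le => x; exact: MK.
Qed.

Lemma hs2_half X Y : (hs2 X < +oo)%E -> (hs2 Y < +oo)%E ->
  (hs2 ((2^-1)%:C *: (X + Y)) < +oo)%E.
Proof.
move=> X2 Y2; apply: le_lt_trans (_ : _ <= hs2 X + hs2 Y)%E _; last first.
  exact: lte_add_pinfty.
rewrite /hs2 -esumD => [|e _|e _]; rewrite ?lee_fin ?sqr_ge0//.
apply: le_esum => e _; rewrite -EFinD lee_fin bopZE bopDE hnormZ exprMn.
rewrite ger0_norm ?invr_ge0//.
have -> : 2^-1 ^+ 2 = 4^-1 :> R by field.
have := parallelogram (X e) (Y e); have := sqr_ge0 (hnorm (X e - Y e)).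
have := sqr_ge0 (hnorm (X e + Y e)); lra.
Qed.

Lemma unitary_adjK U x : bop_unitary U -> bop_adj U (U x) = x.
Proof. by move=> [/(congr1 (fun T : 'B(H) => T x))]. Qed.

Lemma unitary_Kadj U x : bop_unitary U -> U (bop_adj U x) = x.
Proof. by move=> [_ /(congr1 (fun T : 'B(H) => T x))]. Qed.

Lemma unitary_hnorm U x : bop_unitary U -> hnorm (U x) = hnorm x.
Proof.
move=> Uu; apply/(@pexpIrn _ 2) => //; rewrite ?nnegrE ?hnorm_ge0//.
by rewrite -!rinnerxx /rinner bop_adjE unitary_adjK.
Qed.

Lemma unitary_adj_hnorm U x : bop_unitary U -> hnorm (bop_adj U x) = hnorm x.
Proof.
by move=> Uu; rewrite -[in RHS](unitary_Kadj x Uu) (unitary_hnorm _ Uu).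
Qed.

(** The adjoint of the product is U times the adjoint of Z, and an isometry on the left preserves
    every term. *)
Lemma hs2_unitary U Z : bop_unitary U -> hs2 (Z ** bop_adj U) = hs2 Z.
Proof.
move=> Uu; rewrite (@hs2_adjoint _ (U ** bop_adj Z)); last first.
  by move=> x y /=; rewrite bop_adjE bop_adjP.
rewrite hs2_isometry => [|x]; last exact: unitary_hnorm.
by rewrite (@hs2_adjoint Z (bop_adj Z))//; exact: bop_adjE.
Qed.

Lemma bop_absP A : bop_pos (bop_abs A) /\
  bop_abs A ** bop_abs A = bop_adj A ** A.
Proof.
have [|P PP] := @pos_sqrt _ _ (bop_adj A ** A).
  by move=> x /=; rewrite -bop_adjE inner_normE ler0c sqr_ge0.
exact: (@xgetPex _ 0 [set P : 'B(H) | bop_pos P /\ P ** P = bop_adj A ** A]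
  (ex_intro _ P PP)).
Qed.

(** With A = W|A| and T the root of |A|, A = (W T) T. The squared Hilbert-Schmidt norm of T is the
    trace of |A|, and X is the adjoint of W T. *)
Lemma trace_class_factor A : trace_class H A -> exists X Y,
  [/\ forall x y, inner x (A y) = inner (X x) (Y y),
      (hs2 X < +oo)%E & (hs2 Y < +oo)%E].
Proof.
move=> A1; have [P0 PP] := bop_absP A.
have PA x : hnorm (A x) = hnorm (bop_abs A x).
  apply/(@pexpIrn _ 2) => //; rewrite ?nnegrE ?hnorm_ge0//.
  rewrite -!rinnerxx (pos_symmetric P0) /rinner bop_adjE.
  by have /(congr1 (fun T : 'B(H) => T x)) /= -> := PP.
have [W W2 WP] := polar P0 PA.
have [T [T0 TT]] := pos_sqrt P0.
have Tx x : T (T x) = bop_abs A x by rewrite -TT.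
have hT : (hs2 T < +oo)%E.
  rewrite (_ : hs2 T = abs_trace A)//; apply: eq_esum => e _; congr EFin.
  by rewrite -rinnerxx (pos_symmetric T0) Tx.
exists (T ** bop_adj W), T; split=> //.
  move=> x y /=; rewrite symmetric_inner; last exact: pos_symmetric.
  by rewrite bop_adjP// Tx WP.
rewrite (@hs2_adjoint _ (W ** T)); last first.
  move=> x y /=; rewrite symmetric_inner; last exact: pos_symmetric.
  by rewrite bop_adjP.
apply: (le_lt_trans (@hs2_le 2 _ T _)) => [x|]; first exact: W2.
by rewrite lte_mul_pinfty ?lee_fin ?exprn_ge0.
Qed.

End HilbertSchmidt.

Section RealSums.
Context (R : realType) (I : choiceType) (D : set I).
Implicit Types (f p q : I -> R).

(** [rsum] uses the positive and negative parts of f, but any splitting f = p - q into summable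
    nonnegative families will do, because f^+ + q = p + f^-. *)
Lemma rsum_split f p q :
    (forall i, D i -> 0 <= p i) -> (forall i, D i -> 0 <= q i) ->
    (\esum_(i in D) (p i)%:E < +oo)%E -> (\esum_(i in D) (q i)%:E < +oo)%E ->
    (forall i, D i -> f i = p i - q i) ->
  rsum D f = fine (\esum_(i in D) (p i)%:E) - fine (\esum_(i in D) (q i)%:E).
Proof.
move=> p0 q0 sp sq fE.
have fp i : D i -> ((EFin \o f)^\+ i <= (p i)%:E)%E.
  by move=> Di; rewrite funeposE /= ge_max !lee_fin fE// lerBlDr lerDl q0 ?p0.
have fn i : D i -> ((EFin \o f)^\- i <= (q i)%:E)%E.
  move=> Di; rewrite funenegE /= ge_max !lee_fin fE// opprB lerBlDr lerDl.
  by rewrite p0 ?q0.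
have fpq i : D i ->
    ((EFin \o f)^\+ i + (q i)%:E = (p i)%:E + (EFin \o f)^\- i)%E.
  move=> Di; rewrite funeposE funenegE /= -!EFin_max -!EFinD; congr EFin.
  rewrite fE// opprB; have [pq|/ltW pq] := leP (q i) (p i).
    by rewrite max_l ?max_r ?subr_ge0 ?subr_le0// subrK addr0.
  by rewrite max_r ?max_l ?subr_ge0 ?subr_le0// add0r addrC subrK.
have fp0 i : D i -> (0 <= (EFin \o f)^\+ i)%E by move=> _; exact: funepos_ge0.
have fn0 i : D i -> (0 <= (EFin \o f)^\- i)%E by move=> _; exact: funeneg_ge0.
have fin (a : I -> \bar R) b : (forall i, D i -> 0 <= a i)%E ->
    (forall i, D i -> a i <= (b i)%:E)%E -> (\esum_(i in D) (b i)%:E < +oo)%E ->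
    \esum_(i in D) a i \is a fin_num.
  move=> a0 ab sb; rewrite ge0_fin_numE ?esum_ge0//.
  by apply: le_lt_trans sb; apply: le_esum.
have : (\esum_(i in D) (EFin \o f)^\+ i + \esum_(i in D) (q i)%:E =
    \esum_(i in D) (p i)%:E + \esum_(i in D) (EFin \o f)^\- i)%E.
  rewrite -!esumD//; first exact: eq_esum.
have ffp := fin _ _ fp0 fp sp; have ffn := fin _ _ fn0 fn sq.
have fip : \esum_(i in D) (p i)%:E \is a fin_num by apply: (fin _ p).
have fiq : \esum_(i in D) (q i)%:E \is a fin_num by apply: (fin _ q).
rewrite /rsum fineB// => /(congr1 fine); rewrite !fineD//; lra.
Qed.

End RealSums.

Section TraceIdentity.
Context (R : realType) (H : hilbertType R).
Hypothesis H_sep : separable H.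
Implicit Types (A B M U X Y Z : 'B(H)).

Lemma rsum_rinner Y Z : (hs2 Y < +oo)%E -> (hs2 Z < +oo)%E ->
  rsum (@onb R H) (fun e => rinner (Z e) (Y e)) =
  fine (hs2 ((2^-1)%:C *: (Z + Y))) - fine (hs2 ((2^-1)%:C *: (Z - Y))).
Proof.
move=> Y2 Z2; apply: rsum_split => [e _|e _|||e _]; rewrite ?sqr_ge0//.
- exact: hs2_half.
- apply: hs2_half => //; rewrite (_ : hs2 (- Y) = hs2 Y)//.
  by apply: eq_esum => e _; rewrite bopNE hnorm_opp.
- rewrite !bopZE !bopDE bopNE !hnormZ !exprMn hnorm_sqrD hnorm_sqrB.
  rewrite ger0_norm ?invr_ge0//.
  by field.
Qed.

(** The vectors [bop_adj U e] form another orthonormal basis, so this is basis independence of the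
    trace of a product of Hilbert-Schmidt operators. *)
Lemma rsum_rinner_unitary U Y Z : bop_unitary U ->
    (hs2 Y < +oo)%E -> (hs2 Z < +oo)%E ->
  rsum (@onb R H) (fun e => rinner (Z (bop_adj U e)) (Y (bop_adj U e))) =
  rsum (@onb R H) (fun e => rinner (Z e) (Y e)).
Proof.
move=> Uu Y2 Z2; rewrite (rsum_rinner Y2 Z2).
have -> := @rsum_rinner (Y ** bop_adj U) (Z ** bop_adj U).
- by rewrite -(hs2_unitary H_sep (_ *: (Z + Y)) Uu)
    -(hs2_unitary H_sep (_ *: (Z - Y)) Uu).
- by rewrite hs2_unitary.
- by rewrite hs2_unitary.
Qed.

End TraceIdentity.

(** * Exchange of basis sums with integrals, and measurability *)

Section SumIntegralExchange.
Context (R : realType) (H : hilbertType R).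
Hypothesis H_sep : separable H.
Context (d : measure_display) (T : measurableType d) (mu : probability T R).
Implicit Types (f F : H -> T -> R).
Local Notation B := (@onb R H).

Lemma bounded_prob_integrable (h : T -> R) (K : R) : measurable_fun setT h ->
  (forall t, `|h t| <= K) -> mu.-integrable setT (EFin \o h).
Proof.
move=> mh hK; apply: measurable_bounded_integrable => //.
  exact: le_lt_trans (probability_le1 mu measurableT) (ltry _).
exists K; split; first exact: num_real.
by move=> M KM t _ /=; exact: le_trans (hK t) (ltW KM).
Qed.

(** Tonelli along the enumeration, whose padding zeros are the reason for [f 0 t = 0]. The uniform
    bound [K] makes every sum finite, so that [fine] loses nothing. *)
Lemma integral_esum f (K : R) : (forall x t, 0 <= f x t) ->
    (forall t, f 0 t = 0) -> (forall x, measurable_fun setT (f x)) ->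
    (forall t, \esum_(e in B) (f e t)%:E <= K%:E)%E ->
  [/\ mu.-integrable setT (EFin \o fun t => fine (\esum_(e in B) (f e t)%:E)%E),
      (\esum_(e in B) ((\int[mu]_t f e t)%R)%:E < +oo)%E &
      fine (\esum_(e in B) ((\int[mu]_t f e t)%R)%:E)%E =
      \int[mu]_t fine (\esum_(e in B) (f e t)%:E)%E].
Proof.
move=> f0 f00 mf fK; have [E [_ _ _ EE]] := onb_enum_exists H_sep.
have sE t : (\esum_(e in B) (f e t)%:E = \sum_(0 <= n <oo) (f (E n) t)%:E)%E.
  by apply: EE => [x|]; rewrite ?lee_fin ?f00.
have fin t : (\esum_(e in B) (f e t)%:E \is a fin_num)%E.
  rewrite ge0_fin_numE; first exact: le_lt_trans (fK t) (ltry _).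
  by apply: esum_ge0 => e _; rewrite lee_fin.
have mS : measurable_fun setT (fun t => \esum_(e in B) (f e t)%:E)%E.
  apply: (eq_measurable_fun (fun t => \sum_(0 <= n <oo) (f (E n) t)%:E)%E).
    by move=> t _; rewrite sE.
  apply: ge0_emeasurable_sum => [n t _ _|n _]; first by rewrite lee_fin.
  exact/measurable_EFinP.
have f_int x : mu.-integrable setT (EFin \o f x) ->
    ((\int[mu]_t f x t)%R)%:E = (\int[mu]_t (f x t)%:E)%E.
  move=> ifx; rewrite /Rintegral fineK//; exact: integrable_fin_num.
have iS : mu.-integrable setT
    (EFin \o fun t => fine (\esum_(e in B) (f e t)%:E)%E).
  apply: (@bounded_prob_integrable _ K) => [|t].
    exact: measurableT_comp (fine_measurable measurableT) mS.
  rewrite ger0_norm ?fine_ge0 ?esum_ge0// => [|e _]; last by rewrite lee_fin.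
  by rewrite -lee_fin fineK.
have fE_K n t : f (E n) t <= K.
  rewrite -lee_fin (le_trans _ (fK t))// sE.
  rewrite (@nneseriesD1 _ _ n)//; last by move=> k _; rewrite lee_fin.
  by rewrite leeDl// nneseries_ge0// => k _ _; rewrite lee_fin.
have sum_int : (\esum_(e in B) ((\int[mu]_t f e t)%R)%:E =
    \int[mu]_t \esum_(e in B) (f e t)%:E)%E.
  rewrite EE => [|x|]; last 2 first.
  - by rewrite lee_fin; apply: Rintegral_ge0.
  - by under eq_Rintegral do rewrite f00; rewrite Rintegral_cst// mul0r.
  under [RHS]eq_integral do rewrite sE.
  rewrite integral_nneseries//=; last 2 first.
  - by move=> n; exact/measurable_EFinP.
  - by move=> n t _; rewrite lee_fin.
  apply: eq_eseriesr => n _; apply: f_int.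
  apply: (@bounded_prob_integrable _ K) => // t.
  by rewrite ger0_norm.
have SE : ((\int[mu]_t \esum_(e in B) (f e t)%:E) =
    ((\int[mu]_t fine (\esum_(e in B) (f e t)%:E)%E)%R)%:E)%E.
  rewrite /Rintegral fineK; last exact: integrable_fin_num iS.
  by apply: eq_integral => t _; rewrite fineK.
by split=> //; rewrite sum_int SE ?ltry.
Qed.

Lemma rsum_Rintegral F (K : R) : (forall t, F 0 t = 0) ->
    (forall x, measurable_fun setT (F x)) ->
    (forall t, \esum_(e in B) `|F e t|%:E <= K%:E)%E ->
  rsum B (fun e => \int[mu]_t F e t) = \int[mu]_t rsum B (F ^~ t).
Proof.
move=> F0 mF FK.
have part (g : H -> T -> R) : (forall x t, 0 <= g x t <= `|F x t|) ->
    (forall t, g 0 t = 0) -> (forall t, \esum_(e in B) (g e t)%:E <= K%:E)%E.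
  move=> gF g0 t; apply: le_trans (FK t); apply: le_esum => e _.
  by rewrite lee_fin; have /andP[] := gF e t.
pose p x t := Num.max (F x t) 0; pose q x t := Num.max (- F x t) 0.
have pF x t : 0 <= p x t <= `|F x t|.
  by rewrite /p le_max lexx orbT ge_max ler_norm normr_ge0.
have qF x t : 0 <= q x t <= `|F x t|.
  by rewrite /q le_max lexx orbT ge_max -normrN ler_norm normr_ge0.
have pq x t : F x t = p x t - q x t.
  rewrite /p /q; have [h|/ltW h] := leP 0 (F x t).
    by rewrite max_r ?oppr_le0// subr0.
  by rewrite max_l ?oppr_ge0// opprK add0r.
have p0 x t : 0 <= p x t by have /andP[] := pF x t.
have q0 x t : 0 <= q x t by have /andP[] := qF x t.
have p00 t : p 0 t = 0 by rewrite /p F0 maxxx.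
have q00 t : q 0 t = 0 by rewrite /q F0 oppr0 maxxx.
have mp x : measurable_fun setT (p x) by exact: measurable_maxr.
have mq x : measurable_fun setT (q x).
  by apply: measurable_maxr => //; exact: measurableT_comp.
have [iP sP EP] := integral_esum p0 p00 mp (part _ pF p00).
have [iQ sQ EQ] := integral_esum q0 q00 mq (part _ qF q00).
have int_bounded (g : H -> T -> R) x : onb x ->
    (forall x t, 0 <= g x t <= `|F x t|) -> measurable_fun setT (g x) ->
    mu.-integrable setT (EFin \o g x).
  move=> Bx gF mg; apply: (@bounded_prob_integrable _ K) => // t.
  have /andP[g0 gFt] := gF x t; rewrite ger0_norm// (le_trans gFt)//.
  rewrite -lee_fin (le_trans _ (FK t))//; apply: esum_ge; exists [set x].
    by split=> // _ ->.
  by rewrite fsbig_set1.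
(* The integrals of p and q are in general not the positive and negative parts of the integral of F;
   they are still an admissible splitting. *)
rewrite (rsum_split (p := fun e => \int[mu]_t p e t)
  (q := fun e => \int[mu]_t q e t))//.
- rewrite EP EQ -RintegralB//; apply: eq_Rintegral => t _.
  rewrite -(@rsum_split _ _ _ (F ^~ t))//.
  + exact: le_lt_trans (part _ pF p00 t) (ltry _).
  + exact: le_lt_trans (part _ qF q00 t) (ltry _).
- by move=> e _; exact: Rintegral_ge0.
- by move=> e _; exact: Rintegral_ge0.
- move=> e Be; rewrite -RintegralB//; [|exact: int_bounded..].
  by apply: eq_Rintegral => t _; exact: pq.
Qed.

End SumIntegralExchange.

Section Measurability.
Context (R : realType) (G : topologicalGroupType) (H : hilbertType R).

Lemma open_Re_gt (x : R) : open [set z : R[i]^o | x < complex.Re z].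
Proof.
rewrite openE => z /= xz; exists (complex.Re z - x)%:C => /=.
  by rewrite ltcR subr_gt0.
move=> w; rewrite /ball /= => zw; have := le_lt_trans (normc_ge_Re (z - w)) zw.
rewrite ltcR raddfB /= => /ltr_normlP[]; lra.
Qed.

Lemma borel_Re (f : G -> R[i]^o) : borel_map f ->
  measurable_fun [set: borel G] (fun g => complex.Re (f g)).
Proof.
move=> mf mD; apply: (measurability _ (RGenOInfty.measurableE R)) => //.
move=> _ [_ [x ->] <-]; rewrite setTI.
have := mf measurableT [set z : R[i]^o | x < complex.Re z].
rewrite setTI (_ : _ @^-1` `]x, +oo[%classic =
  f @^-1` [set z : R[i]^o | x < complex.Re z]).
  by apply; apply: sub_sigma_algebra; exact: open_Re_gt.
by apply/seteqP; split=> g /=; rewrite in_itv/= andbT.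
Qed.

(** Expanding B U(g) y in the basis writes the function as a pointwise limit of finite sums of
    products of matrix coefficients of U. *)
Lemma measurable_rinner_sandwich (U : G -> 'B(H)) (B : 'B(H)) (x y : H) :
    separable H ->
    (forall phi psi,
      measurable_fun [set: borel G] (fun g => rinner phi (U g psi))) ->
  measurable_fun [set: borel G] (fun g => rinner (U g x) (B (U g y))).
Proof.
move=> H_sep mU; have [E E_enum] := onb_enum_exists H_sep.
pose h (N : nat) (g : borel G) := \sum_(0 <= k < N)
  (rinner (bop_adj B (E k)) (U g y) * rinner (E k) (U g x) +
   rinner (bop_adj B ('i *: E k)) (U g y) * rinner ('i *: E k) (U g x)).
apply: (@measurable_fun_cvg _ _ _ _ h) => [N|g _].
  apply: measurable_sum => k.
  by apply: measurable_funD; exact: measurable_funM.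
have := hcvg_rinner (y := U g x) (onb_expansion E_enum (B (U g y))).
rewrite (rinnerC (U g x)) (_ : (fun N => _) = h ^~ g)//.
apply/funext => N; rewrite /h; elim: N => [|N IH].
  by rewrite !big_nil rinner0l.
rewrite !big_nat_recr//= rinnerDl IH; congr (_ + _).
rewrite /rinner innerZl !bop_adjP// !innerZl.
case: (inner _ (B _)) => a b; case: (inner _ (U g x)) => c d /=; ring.
Qed.

End Measurability.

Section IntegralBounds.
Context d (T : measurableType d) (R : realType) (mu : probability T R).

Lemma Rintegral_prob_cst (c : R) : \int[mu]_t c = c.
Proof.
rewrite Rintegral_cst// [X in _ * X](_ : _ = 1) ?mulr1//.
by have /(congr1 fine) := probability_setT mu.
Qed.

Lemma Rintegral_prob_le (h : T -> R) (K : R) : measurable_fun setT h ->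
  (forall t, `|h t| <= K) -> \int[mu]_t h t <= K.
Proof.
move=> mh hK; rewrite -[leRHS]Rintegral_prob_cst; apply: le_Rintegral => //.
- exact: bounded_prob_integrable hK.
- apply: (@bounded_prob_integrable _ _ _ _ _ `|K|) => //.
- by move=> t _; exact: le_trans (ler_norm _) (hK t).
Qed.

Lemma Rintegral_sum (I : Type) (r : seq I) (h : I -> T -> R) :
    (forall i, mu.-integrable setT (EFin \o h i)) ->
  mu.-integrable setT (EFin \o fun t => \sum_(i <- r) h i t) /\
  \int[mu]_t \sum_(i <- r) h i t = \sum_(i <- r) \int[mu]_t h i t.
Proof.
move=> ih; elim: r => [|i r [IH1 IH2]].
  under [X in EFin \o X]eq_fun do rewrite big_nil.
  under eq_Rintegral do rewrite big_nil.
  rewrite big_nil Rintegral_prob_cst; split=> //.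
  by apply: (@bounded_prob_integrable _ _ _ _ _ 0) => // t; rewrite normr0.
under [X in EFin \o X]eq_fun do rewrite big_cons.
under eq_Rintegral do rewrite big_cons.
rewrite big_cons RintegralD// IH2; split=> //.
by have := integrableD measurableT (ih i) IH1.
Qed.

End IntegralBounds.

(** * The dual map and its complete positivity *)

Section RealRiesz.
Context (R : realType) (H : hilbertType R).
Hypothesis H_sep : separable H.
Implicit Types (x y z : H).

Lemma rinner_scale (a : R[i]) x y : rinner (a *: x) y = rinner x (conjc a *: y).
Proof. by rewrite /rinner innerZl innerZr. Qed.

Lemma hnorm_dual_le x (K : R) : 0 <= K ->
  (forall y, rinner x y <= K * hnorm y) -> hnorm x <= K.
Proof.
move=> K0 /(_ x); rewrite rinnerxx expr2.
have [->//|x0] := eqVneq (hnorm x) 0.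
by rewrite ler_pM2r// lt_neqAle eq_sym x0 hnorm_ge0.
Qed.

Lemma riesz_real (rho : H -> R) (K : R) :
    (forall x y, rho (x + y) = rho x + rho y) ->
    (forall (r : R) x, rho (r%:C *: x) = r * rho x) ->
    (forall x, rho x <= K * hnorm x) ->
  exists y, forall x, rho x = rinner y x.
Proof.
move=> rhoD rhoZ rhoK; have [E E_enum] := onb_enum_exists H_sep.
have rhoZc b c x : rho ((b +i* c) *: x) = b * rho x + c * rho ('i *: x).
  rewrite -!rhoZ -rhoD scalerA -scalerDl; congr (rho (_ *: _)).
  by congr (_ +i* _) => /=; ring.
(* A complex-linear functional with real part rho must be rho(x) - i rho(ix). *)
have [|x|y yE] := @riesz _ _ E E_enum (fun x => rho x -i* rho ('i *: x)) K.
- move=> [b c] x z; rewrite scalerDr !rhoD scalerA.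
  have -> : ('i * (b +i* c))%C = (- c) +i* b by congr (_ +i* _) => /=; ring.
  by rewrite (rhoZc b c) (rhoZc (- c) b); congr (_ +i* _) => /=; ring.
- exact: rhoK.
- by exists y => x; have /(congr1 (@complex.Re R)) := yE x.
Qed.

End RealRiesz.

Section DualMap.
Context (R : realType) (G : topologicalGroupType) (H : hilbertType R).
Hypothesis H_sep : separable H.
Variables (U : G -> 'B(H)) (mu : probability (borel G) R).
Hypothesis U_rep : projective_representation U.
Implicit Types (x y : H) (A B : 'B(H)).

Let U_unitary g : bop_unitary (U g).
Proof. exact: prep_unitary. Qed.

Let mU phi psi : measurable_fun [set: borel G] (fun g => rinner phi (U g psi)).
Proof. exact: borel_Re (prep_borel U_rep phi psi). Qed.

Let form B x y g := rinner (U g x) (B (U g y)).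

Let form_integrable B x y : mu.-integrable setT (EFin \o form B x y).
Proof.
have [M M0 BM] := bop_bounded B.
apply: (@bounded_prob_integrable _ _ _ _ _ (M * hnorm y * hnorm x)).
  exact: measurable_rinner_sandwich.
move=> g; rewrite (le_trans (ler_norm_rinner _ _))// unitary_hnorm// mulrC.
by rewrite ler_wpM2r ?hnorm_ge0// (le_trans (BM _))// unitary_hnorm.
Qed.

Lemma dual_exists B : exists Q : 'B(H), forall x y,
  rinner x (Q y) = \int[mu]_g rinner (U g x) (B (U g y)).
Proof.
have [M M0 BM] := bop_bounded B.
have form_le x y : \int[mu]_g form B x y g <= M * hnorm y * hnorm x.
  apply: Rintegral_prob_le; first exact: measurable_rinner_sandwich.
  move=> g; rewrite (le_trans (ler_norm_rinner _ _))// unitary_hnorm// mulrC.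
  by rewrite ler_wpM2r ?hnorm_ge0// (le_trans (BM _))// unitary_hnorm.
have [y|q qE] := choice (P := fun y z => forall x,
    \int[mu]_g form B x y g = rinner z x).
  apply: (@riesz_real _ _ H_sep _ (M * hnorm y)) => [x z|r x|x];
    last exact: form_le.
  - rewrite -RintegralD//; apply: eq_Rintegral => g _.
    by rewrite /form bopD rinnerDl.
  - rewrite -RintegralZl//; apply: eq_Rintegral => g _.
    by rewrite /form bopZ rinnerZl.
(* [q] is determined by real parts only; a complex scalar is handled by moving it, conjugated, to
   the other argument. *)
have lq : linear q.
  move=> a y z; apply: rinner_ext => x.
  rewrite rinnerDl rinner_scale -!qE -RintegralD//; apply: eq_Rintegral => g _.
  by rewrite /form !bopD !bopZ rinnerDr [in RHS]rinner_scale conjcK.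
have qM y : hnorm (q y) <= M * hnorm y.
  apply: hnorm_dual_le => [|x]; first by rewrite mulr_ge0 ?hnorm_ge0 ?ltW.
  by rewrite -qE form_le.
have [Q QE] := bop_exists lq qM.
by exists Q => x y; rewrite QE rinnerC -qE.
Qed.

(** The amplified form of [Q] at x is the integral over g of that of [B] at the vectors [U g (x i)],
    which is nonnegative for each g. *)
Lemma dual_completely_positive (Q : 'B(H) -> 'B(H)) :
    (forall B x y, rinner x (Q B y) = \int[mu]_g rinner (U g x) (B (U g y))) ->
  completely_positive Q.
Proof.
move=> QE n B B0 x.
(* The left argument z is independent of y so that z = y gives the real part and z = iy the
   imaginary part. *)
pose s (y : 'I_n -> H) (C : 'I_n -> 'I_n -> 'B(H)) (z : 'I_n -> H) : R :=
  \sum_(p : 'I_n * 'I_n) rinner (z p.1) (C p.1 p.2 (y p.2)).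
have sumE (C : 'I_n -> 'I_n -> 'B(H)) (y : 'I_n -> H) :
    \sum_i \sum_j inner (y i) (C i j (y j)) =
    s y C y +i* s y C (fun i => 'i *: y i).
  rewrite pair_big /s /=.
  elim/big_ind3: _ => [//|a1 a2 b1 b2 c1 c2 -> ->|p _]; last exact: innerE.
  by [].
have sQ (y z : 'I_n -> H) : s y (fun i j => Q (B i j)) z =
    \int[mu]_g s (fun i => U g (y i)) B (fun i => U g (z i)).
  rewrite /s (Rintegral_sum _ _).2; first by apply: eq_bigr => p _; rewrite QE.
  by move=> p; exact: form_integrable.
rewrite sumE lecE /= !sQ; apply/andP; split.
  apply/eqP; rewrite -[RHS](Rintegral_prob_cst mu); apply: eq_Rintegral => g _.
  have := B0 (fun i => U g (x i)); rewrite sumE lecE /= => /andP[/eqP <- _].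
  by apply: eq_bigr => p _; rewrite bopZ.
apply: Rintegral_ge0 => g _.
by have := B0 (fun i => U g (x i)); rewrite sumE lecE /= => /andP[].
Qed.

End DualMap.

(** * Trace duality and the conclusion *)

Section TraceDuality.
Context (R : realType) (G : topologicalGroupType) (H : hilbertType R).
Hypothesis H_sep : separable H.
Variables (U : G -> 'B(H)) (mu : probability (borel G) R).
Hypothesis U_rep : projective_representation U.
Implicit Types (x y : H) (A B X Y Z : 'B(H)).
Local Notation basis := (@onb R H).

Lemma esum_norm_rinner_le X Y :
  (\esum_(e in basis) `|rinner (X e) (Y e)|%:E <= hs2 X + hs2 Y)%E.
Proof.
rewrite /hs2 -esumD => [|e _|e _]; rewrite ?lee_fin ?sqr_ge0//.
apply: le_esum => e _; rewrite -EFinD lee_fin.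
have := ler_norm_rinner_sqr (X e) (Y e).
have := sqr_ge0 (hnorm (X e)); have := sqr_ge0 (hnorm (Y e)); lra.
Qed.

Lemma trace_duality A B (S Q : 'B(H)) : trace_class H A ->
    is_weak_integral mu (fun g => U g ** A ** bop_adj (U g)) S ->
    (forall x y, rinner x (Q y) = \int[mu]_g rinner (U g x) (B (U g y))) ->
  trace (Q ** A) = trace (B ** S).
Proof.
move=> A1 SE QE; have [X [Y [AE X2 Y2]]] := trace_class_factor H_sep A1.
have Uu g : bop_unitary (U g) by exact: prep_unitary.
have mU phi psi : measurable_fun [set: borel G] (fun g => rinner phi (U g psi)).
  exact: borel_Re (prep_borel U_rep phi psi).
have [K K0 BK] := bop_bounded B.
(* The adjoint of U(g)^* B U(g), since it has to act on the left factor of the inner product, next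
   to [X]. *)
pose M g := bop_adj (U g) ** (bop_adj B ** U g).
have ME g x y : inner (M g x) y = inner (U g x) (B (U g y)).
  by rewrite /= !bop_adjP.
have MK g x : hnorm (bop_adj (M g) x) <= K * hnorm x.
  have -> : bop_adj (M g) x = bop_adj (U g) (B (U g x)).
    by apply: inner_ext => z; rewrite !bop_adjP// innerC ME -innerC.
  by rewrite unitary_adj_hnorm// (le_trans (BK _))// unitary_hnorm.
pose L := K ^+ 2 * fine (hs2 X) + fine (hs2 Y).
have fin (Z : 'B(H)) : (hs2 Z < +oo)%E -> hs2 Z = (fine (hs2 Z))%:E.
  by move=> Z2; rewrite fineK// ge0_fin_numE ?hs2_ge0.
(* c = 1 gives the real part of the trace and c = 'i the imaginary part; modulus 1 leaves the
   Hilbert-Schmidt bounds unchanged. *)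
have key (c : R[i]) : csq c = 1 ->
    rsum basis (fun e => rinner (c *: e) (Q (A e))) =
    rsum basis (fun e => rinner (c *: e) (B (S e))).
  move=> c1; pose Z g : 'B(H) := c *: (X ** M g).
  have ZL g : (hs2 (Z g) <= (K ^+ 2)%:E * hs2 X)%E.
    apply: le_trans (hs2_comp_le H_sep X (MK g)).
    by apply: le_esum => e _; rewrite bopZE hnorm_sqrZ c1 mul1r.
  have Z2 g : (hs2 (Z g) < +oo)%E.
    by rewrite (le_lt_trans (ZL g))// fin// -EFinM ltry.
  have ZYL g : (hs2 (Z g) + hs2 Y <= L%:E)%E.
    by rewrite /L EFinD EFinM -!fin// leeD2r.
  have QF g e : rinner (U g (c *: e)) (B (U g (A e))) = rinner (Z g e) (Y e).
    by rewrite /rinner -ME bopZ innerZl AE -innerZl.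
  (* The same pair [Z g], [Y] as in [QF], but evaluated at [bop_adj (U g) e]; summation over the
     basis removes the difference. *)
  have SF g e : rinner (bop_adj B (c *: e)) (U g (A (bop_adj (U g) e))) =
      rinner (Z g (bop_adj (U g) e)) (Y (bop_adj (U g) e)).
    have XM : (X ** M g) (bop_adj (U g) e) = X (bop_adj (U g) (bop_adj B e)).
      by rewrite /= unitary_Kadj.
    by rewrite /rinner -bop_adjP// AE bopZE XM !bopZ.
  transitivity (rsum basis (fun e =>
      \int[mu]_g rinner (U g (c *: e)) (B (U g (A e))))).
    by congr rsum; apply/funext => e; rewrite QE.
  rewrite (@rsum_Rintegral _ _ H_sep _ _ _
    (fun e (g : borel G) => rinner (U g (c *: e)) (B (U g (A e)))) L);
    first last.
  - move=> g; apply: le_trans (ZYL g).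
    apply: le_trans (esum_norm_rinner_le _ _).
    by apply: le_esum => e _; rewrite QF.
  - by move=> x; exact: measurable_rinner_sandwich.
  - by move=> g; rewrite scaler0 !bop0 rinner0l.
  transitivity (rsum basis (fun e => \int[mu]_g
      rinner (bop_adj B (c *: e)) (U g (A (bop_adj (U g) e))))); last first.
    congr rsum; apply/funext => e.
    rewrite -[RHS]/(complex.Re (inner _ _)) -bop_adjP//.
    by have [_ ->] := SE (bop_adj B (c *: e)) e.
  rewrite (@rsum_Rintegral _ _ H_sep _ _ _
    (fun e (g : borel G) =>
      rinner (bop_adj B (c *: e)) (U g (A (bop_adj (U g) e)))) L); first last.
  - move=> g; apply: le_trans (ZYL g).
    rewrite -(hs2_unitary H_sep (Z g) (Uu g)) -(hs2_unitary H_sep Y (Uu g)).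
    apply: le_trans (esum_norm_rinner_le _ _).
    by apply: le_esum => e _; rewrite SF.
  - move=> x; apply/measurable_EFinP.
    by have [[/integrableP[]]] := SE (bop_adj B (c *: x)) x.
  - by move=> g; rewrite scaler0 !bop0 rinner0l.
  apply: eq_Rintegral => g _.
  transitivity (rsum basis (fun e => rinner (Z g e) (Y e))).
    by congr rsum; apply/funext => e; rewrite QF.
  rewrite -(rsum_rinner_unitary H_sep (Uu g) Y2 (Z2 g)).
  by congr rsum; apply/funext => e; rewrite SF.
have re (f : H -> H) : (fun e => complex.Re (inner e (f e))) =
    (fun e => rinner (1 *: e) (f e)).
  by apply/funext => e; rewrite scale1r.
have im (f : H -> H) : (fun e => complex.Im (inner e (f e))) =
    (fun e => rinner ('i *: e) (f e)).
  by apply/funext => e; rewrite innerE.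
rewrite /trace /csum !re !im; congr (_ +i* _); apply: key.
- by rewrite /csq /= expr1n expr0n addr0.
- by rewrite /csq /= expr1n expr0n add0r.
Qed.

End TraceDuality.

Local Close Scope complex_scope.

Theorem proposition4p4 (R : realType) (G : topologicalGroupType)
    (H : hilbertType R) (U : G -> 'B(H))
    (mu : R -> probability (borel G) R) (S : R -> 'B(H) -> 'B(H))
    (G_lc : locally_compact [set: G]) (G_sc : @second_countable G)
    (G_T2 : hausdorff_space G) (H_sep : separable H)
    (U_rep : projective_representation U)
    (mu_semi : convolution_semigroup mu)
    (S_semi : contraction_semigroup S)
    (S_def : forall (t : R) (A : 'B(H)), 0 <= t -> trace_class H A ->
      is_weak_integral (mu t) (fun g => U g ** A ** bop_adj (U g)) (S t A)) :
  quantum_dynamical_semigroup S.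
Proof.
have [S_cont S_contr] := S_semi; split=> // t t0.
have [S_lin S_bound] := S_contr t t0.
have [Q QE] := choice (dual_exists H_sep (mu t) U_rep).
have duality B A : trace_class H A -> trace (Q B ** A) = trace (B ** S t A).
  by move=> A1; apply: trace_duality (S_def t A t0 A1) (QE B).
have Uu g : bop_unitary (U g) by exact: prep_unitary.
split=> //.
- by exists 1.
- move=> A A1 A0 x; have [_ ->] := S_def t A t0 A1 x x.
  have pos g : 0 <= inner x ((U g ** A ** bop_adj (U g)) x).
    by rewrite /= -bop_adjP.
  rewrite lecE /=; apply/andP; split.
    rewrite -[X in _ == X](Rintegral_prob_cst (mu t)); apply/eqP.
    by apply: eq_Rintegral => g _; have /ger0_Im := pos g.
  by apply: Rintegral_ge0 => g _; have := pos g; rewrite lecE => /andP[].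
(* At B = 1 the integrand is the constant <x,y>, and [mu t] has total mass one. *)
- have Q1 : Q (bop_id H) = bop_id H.
    apply: bop_ext => y; apply: rinner_ext => x; rewrite rinnerC QE.
    rewrite -[RHS](Rintegral_prob_cst (mu t)); apply: eq_Rintegral => g _.
    by rewrite /rinner bop_adjE// unitary_adjK// -/(rinner x y) rinnerC.
  have compE A : bop_id H ** A = A by apply: bop_ext => y.
  by move=> A A1; have := duality (bop_id H) A A1; rewrite Q1 !compE => ->.
- exists Q => //.
  exact: (dual_completely_positive H_sep U_rep QE).
Qed.
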